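(* Let $(M,F)$ be a conic pseudo-Finsler surface and let $\overline F=e^{\phi}F$ be an anisotropic conformal transformation of $F$. Then: (i) The transformation is horizontal $C$-anisotropic conformal if and only if either $F$ is Riemannian or $\phi_{,2}=0$. (ii) The transformation is horizontal $\overline C$-anisotropic conformal if and only if $\mathcal I=\frac{\varepsilon}{2}(\ln\rho-4\phi)_{;2}$ or $\phi_{,2}=\phi_{,1}\phi_{;2}$. (iii) If $F$ and $\overline F$ are both non-Riemannian, then the transformation is both horizontal $C$-anisotropic conformal and horizontal $\overline C$-anisotropic conformal if and only if the geodesic spray is invariant.
   Context: $M$ is a smooth 2-dimensional manifold with local coordinates $(x^i)$ and induced coordinates $(x^i,y^i)$ on $TM$; $\partial_i=\partial/\partial x^i$, $\dot\partial_i=\partial/\partial y^i$. $\mathcal A\subset TM_0=TM\setminus(0)$ is a conic sub-bundle (non-empty, open, invariant under $y\mapsto\lambda y$, $\lambda>0$, projecting onto $M$). A function is $h(r)$ if it is positively homogeneous of degree $r$ in $y$. A conic pseudo-Finsler metric is a smooth $h(1)$ function $F:\mathcal A\to\mathbb R$ with $g_{ij}=\frac12\dot\partial_i\dot\partial_jF^2$ non-degenerate; $(M,F)$ is then a conic pseudo-Finsler surface. Modified Berwald frame: $\ell_i=\dot\partial_iF$, $\ell^i=y^i/F$, $g_{ij}=\ell_i\ell_j+\varepsilon m_im_j$ with $\varepsilon=\pm1$, $m^i=g^{ij}m_j$, so $\ell^i\ell_i=1$, $\ell^im_i=\ell_im^i=0$, $m^im_i=\varepsilon$. Spray coefficients: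 $G^i=\frac14g^{ik}(y^m\partial_m\dot\partial_kF^2-\partial_kF^2)$; $G^j_i=\dot\partial_iG^j$; $\delta_i=\partial_i-G^j_i\dot\partial_j$; geodesic spray $S=y^i\partial_i-2G^i\dot\partial_i$. The main scalar $\mathcal I$ is the $h(0)$ function defined by $FC_{ijk}=\mathcal I m_im_jm_k$, where $C_{ijk}=\frac12\dot\partial_kg_{ij}$ is the Cartan tensor and $C^i_{jk}=g^{ir}C_{rjk}$; $F$ is Riemannian iff $\mathcal I=0$. For smooth $f$ on $\mathcal A$ the scalar derivatives are defined by $F\dot\partial_if=f_{;1}\ell_i+f_{;2}m_i$ and $\delta_if=f_{,1}\ell_i+f_{,2}m_i$. An anisotropic conformal transformation (change) of $F$ is $\overline F(x,y)=e^{\phi(x,y)}F(x,y)$ with $\phi$ a smooth $h(0)$ function on $\mathcal A$ such that $\varepsilon+\sigma-(\phi_{;2})^2\ne0$, where $\sigma=\phi_{;2;2}+\varepsilon\mathcal I\phi_{;2}+2(\phi_{;2})^2$; put $\rho=\frac{1}{\sigma+\varepsilon-(\phi_{;2})^2}$, and $(\ln\rho)_{;2}$ means $\rho_{;2}/\rho$. Bars denote the objects associated with $\overline F$ (e.g. $\overline C^i_{jk}$, $\overline G^i$, $\overline S$); the frame of $\overline F$ is taken with the same sign $\varepsilon$, $\overline m_i=e^{\phi}\sqrt{\varepsilon/\rho}\,m_i$. The change is horizontal $C$-anisotropic conformal if $(\delta_i\phi)C^i_{jk}=0$, and horizontal $\overline C$-anisotropic conformal if $(\delta_i\phi)\overline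 C^i_{jk}=0$. The geodesic spray is invariant if $\overline S=S$, i.e. $\overline G^i=G^i$.
   Formalization: In (i) and (ii) the equivalences, with their ''or'', are stated at each point of 𝒜, since the global alternatives fail for smooth data; in (iii) ''non-Riemannian'' means Riemannian on no non-empty open subset of 𝒜, since merely ''not Riemannian everywhere'' makes the claim false. *)

(* Defs.v *)
From mathcomp Require Export all_boot all_order all_algebra.
From mathcomp Require Export all_classical all_reals all_analysis.
Set Implicit Arguments.
Unset Strict Implicit.
Unset Printing Implicit Defensive.
Import Order.TTheory GRing.Theory Num.Theory numFieldNormedType.Exports.
Local Open Scope classical_set_scope.
Local Open Scope ring_scope.

(* C^oo on an open set U: all iterated directional derivatives exist and are
   Frechet differentiable (hence continuous) at the points of U. *)
Definition smooth_on (R : realType) (V W : normedModType R) (U : set V)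
    (f : V -> W) : Prop :=
  forall (s : seq V) (p : V), U p ->
    differentiable (foldr (fun v g => 'D_v g) f s) p.

Record chart (R : realType) (M : topologicalType) := Chart {
  cdom : set M ;
  cmap : M -> 'rV[R]_2 ;
  cinv : 'rV[R]_2 -> M ;
  cdom_open : open cdom ;
  cimg_open : open (cmap @` cdom) ;
  cmapK : {in cdom, cancel cmap cinv} ;
  cmap_continuous : {in cdom, continuous cmap} ;
  cinv_continuous : {in cmap @` cdom, continuous cinv} }.

(* Local coordinates (x, y) = ((x^1, x^2), (y^1, y^2)) on TM. *)
Notation tcoord R := ('rV[R]_2 * 'rV[R]_2)%type.

Section Atlas.
Variables (R : realType) (M : topologicalType) (I : Type) (c : I -> chart R M).

Definition overlap (a b : I) : set 'rV[R]_2 :=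
  cmap (c a) @` (cdom (c a) `&` cdom (c b)).

Definition transition (a b : I) (x : 'rV[R]_2) : 'rV[R]_2 :=
  cmap (c b) (cinv (c a) x).

(* Induced change of coordinates on TM. *)
Definition ttransition (a b : I) (p : tcoord R) : tcoord R :=
  (transition a b p.1, 'D_(p.2) (transition a b) p.1).

(* c is a smooth atlas making M a smooth 2-dimensional manifold. *)
Definition smooth_surface : Prop :=
  [/\ hausdorff_space M, @second_countable M,
      (forall z : M, exists a, cdom (c a) z) &
      (forall a b, smooth_on (overlap a b) (transition a b))].

(* Subsets of TM and functions on them are given by their expressions in the
   charts of the atlas, subject to the transformation law on overlaps. *)
Definition conic_subbundle (A : I -> set (tcoord R)) : Prop :=
  [/\ (exists a p, A a p),
      (forall a, open (A a)),
      (forall a p, A a p -> (cmap (c a) @` cdom (c a)) p.1 /\ p.2 != 0),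
      (forall a p (t : R), A a p -> 0 < t -> A a (p.1, t *: p.2)) &
      (forall a x, (cmap (c a) @` cdom (c a)) x -> exists y, A a (x, y)) /\
      (forall a b p, overlap a b p.1 -> A a p -> A b (ttransition a b p))].

Definition smooth_function (A : I -> set (tcoord R)) (f : I -> tcoord R -> R) :=
  (forall a, smooth_on (A a) (f a)) /\
  (forall a b p, overlap a b p.1 -> A a p -> f b (ttransition a b p) = f a p).

Definition homogeneous (A : I -> set (tcoord R)) (r : nat)
    (f : I -> tcoord R -> R) : Prop :=
  forall a p (t : R), A a p -> 0 < t -> f a (p.1, t *: p.2) = t ^+ r * f a p.

End Atlas.

Section LocalFormulas.
Variables (R : realType).
Implicit Types (F f phi : tcoord R -> R) (m : tcoord R -> 'rV[R]_2)
  (p : tcoord R) (i j k : 'I_2).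

Definition dx i f : tcoord R -> R := 'D_(delta_mx 0 i, 0) f.
Definition dy i f : tcoord R -> R := 'D_(0, delta_mx 0 i) f.

Definition gmx F p : 'M[R]_2 :=
  \matrix_(i, j) (2^-1 * dy i (dy j (fun q => F q ^+ 2)) p).

Definition ginv F p : 'M[R]_2 := invmx (gmx F p).

Definition cartan F i j k p : R := 2^-1 * dy k (fun q => gmx F q i j) p.

(* C^i_{jk} *)
Definition cartan_up F i j k p : R := \sum_r ginv F p i r * cartan F r j k p.

(* F is Riemannian iff dot-partial_k g_ij = 0, i.e. the Cartan tensor vanishes.
   The pointwise condition is needed: (delta_i phi) C^i_{jk} amounts to a product
   of two smooth functions, which may vanish on all of A although neither
   factor does. *)
Definition riemannian_at F p : Prop :=
  forall i j k, dy k (fun q => gmx F q i j) p = 0.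

Definition spray F i p : R :=
  4^-1 * \sum_k ginv F p i k *
    (\sum_r p.2 0 r * dx r (dy k (fun q => F q ^+ 2)) p
     - dx k (fun q => F q ^+ 2) p).

(* delta_i f = partial_i f - G^j_i dot-partial_j f *)
Definition hdelta F i f p : R :=
  dx i f p - \sum_j dy i (spray F j) p * dy j f p.

Definition ell F p : 'rV[R]_2 := \row_i dy i F p.

(* The coordinates (w1, w2) of a covector w in the coframe (ell, m), i.e.
   w_i = w1 ell_i + w2 m_i (see frame_coordP). *)
Definition coframe F m p : 'M[R]_2 :=
  \matrix_(i, j) (if i == 0 then ell F p 0 j else m p 0 j).
Definition frame_coord F m p (w : 'rV[R]_2) : 'rV[R]_2 :=
  w *m invmx (coframe F m p).

(* f_{;2}, f_{,1} and f_{,2} *)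
Definition vder2 F m f p : R :=
  frame_coord F m p (\row_i (F p * dy i f p)) 0 1.
Definition hder1 F m f p : R := frame_coord F m p (\row_i hdelta F i f p) 0 0.
Definition hder2 F m f p : R := frame_coord F m p (\row_i hdelta F i f p) 0 1.

Definition sigma (eps : R) F m (Is : tcoord R -> R) phi p : R :=
  vder2 F m (vder2 F m phi) p + eps * Is p * vder2 F m phi p
  + 2 * vder2 F m phi p ^+ 2.

Definition rho (eps : R) F m (Is : tcoord R -> R) phi p : R :=
  (sigma eps F m Is phi p + eps - vder2 F m phi p ^+ 2)^-1.

Definition change F phi p : R := expR (phi p) * F p.

(* (delta_i phi) C^i_{jk} = 0 at a point, where delta_i is that of F and C is
   the Cartan tensor of F' (F' = F or F' = change F phi). *)
Definition horizontal_C_at F F' phi p : Prop :=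
  forall j k, \sum_i hdelta F i phi p * cartan_up F' i j k p = 0.

Lemma frame_coordP F m p (eps : R) (w : 'rV[R]_2) :
  gmx F p \in unitmx ->
  (forall i j, gmx F p i j =
     ell F p 0 i * ell F p 0 j + eps * (m p 0 i * m p 0 j)) ->
  w = frame_coord F m p w 0 0 *: ell F p + frame_coord F m p w 0 1 *: m p.
Proof.
move=> gU gE.
have coE : gmx F p = (\matrix_(i, j) (if j == 0 then ell F p 0 i
                      else eps * m p 0 i)) *m coframe F m p.
  apply/matrixP => i j.
  by rewrite gE [RHS]mxE big_ord_recl big_ord1 /coframe !mxE /= mulrA.
have cU : coframe F m p \in unitmx.
  by move: gU; rewrite coE unitmx_mul => /andP[].
rewrite -[w in LHS](mulmxKV cU) -/(frame_coord F m p w).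
apply/rowP => j; rewrite [LHS]mxE big_ord_recl big_ord1.
rewrite (_ : lift _ _ = 1); last exact/val_inj.
by rewrite [RHS]mxE; congr (_ + _); rewrite [RHS]mxE; congr (_ * _);
  rewrite mxE.
Qed.

End LocalFormulas.

Section Surface.
Variables (R : realType) (M : topologicalType) (I : Type) (c : I -> chart R M).
Variable A : I -> set (tcoord R).

(* Non-degeneracy forces F != 0 on A: in dimension 2, g_ij has rank at most 1
   at a zero of F. F may be negative. *)
Definition conic_pseudo_finsler (F : I -> tcoord R -> R) : Prop :=
  [/\ smooth_function c A F, homogeneous A 1 F &
      forall a p, A a p -> gmx (F a) p \in unitmx].

(* The covector field m is determined by F only up to sign and a global choice
   need not exist on TM, so one smooth frame per chart is given; the frames of
   different charts are not required to agree on overlaps. *)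
Definition berwald_frame (F : I -> tcoord R -> R) (eps : R)
    (m : I -> tcoord R -> 'rV[R]_2) : Prop :=
  (eps = 1 \/ eps = -1) /\
  forall a, smooth_on (A a) (m a) /\
    forall p, A a p -> forall i j, gmx (F a) p i j =
      ell (F a) p 0 i * ell (F a) p 0 j + eps * (m a p 0 i * m a p 0 j).

Definition main_scalar (F : I -> tcoord R -> R) (m : I -> tcoord R -> 'rV[R]_2)
    (Is : I -> tcoord R -> R) : Prop :=
  forall a p, A a p -> forall i j k,
    F a p * cartan (F a) i j k p = Is a p * m a p 0 i * m a p 0 j * m a p 0 k.

(* phi defines an anisotropic conformal change of F. *)
Definition anisotropic_conformal (F : I -> tcoord R -> R) (eps : R)
    (m : I -> tcoord R -> 'rV[R]_2) (Is phi : I -> tcoord R -> R) : Prop :=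
  [/\ smooth_function c A phi, homogeneous A 0 phi &
      forall a p, A a p ->
        eps + sigma eps (F a) (m a) (Is a) (phi a) p
        - vder2 (F a) (m a) (phi a) p ^+ 2 != 0].

(* Being (non-)Riemannian is understood locally: F is Riemannian on no
   non-empty open part of A. This holds in particular when the main scalar
   vanishes nowhere. "Not Riemannian on all of A" would not suffice for the
   theorem on spray invariance: let F be Euclidean over an open set U of M and
   non-Riemannian elsewhere, and let phi be a bump function on M with support
   in U. *)
Definition non_riemannian (F : I -> tcoord R -> R) : Prop :=
  forall a (U : set (tcoord R)), open U -> U `<=` A a -> U !=set0 ->
    exists2 p, U p & ~ riemannian_at (F a) p.

Definition horizontal_C (F F' phi : I -> tcoord R -> R) : Prop :=
  forall a p, A a p -> horizontal_C_at (F a) (F' a) (phi a) p.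

Definition same_geodesic_spray (F F' : I -> tcoord R -> R) : Prop :=
  forall a p, A a p -> forall i, spray (F' a) i p = spray (F a) i p.

End Surface.

(* Main.v *)
Require Import Defs.
From mathcomp Require Import all_boot all_order all_algebra.
From mathcomp Require Import all_classical all_reals all_analysis.
From mathcomp Require Import ring lra.
Set Implicit Arguments.
Unset Strict Implicit.
Unset Printing Implicit Defensive.
Import Order.TTheory GRing.Theory Num.Theory numFieldNormedType.Exports.
Local Open Scope classical_set_scope.
Local Open Scope ring_scope.

(** Everything happens in one chart, on an open conic set of pairs (x, y), and
    rests on derivatives of a few explicit functions of (x, y).

    For the metric F, Euler's relation F = y^i l_i, with l_i the fibre
    derivatives of F, forces y^i m_i = 0, hence
      F dy_k l_i = eps m_i m_k,
      F dy_k m_i = - (l_i - eps I m_i) m_k,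
    and F dy_k h = h_;2 m_k for every h of degree 0.  Put f = phi_;2 and
    L_i = l_i + f m_i, so that the fibre derivatives of Fbar = e^phi F are
    e^phi L_i.  With W = 1 / rho = sigma + eps - f^2 these formulas give
      gbar_ij = e^(2 phi) (L_i L_j + W m_i m_j),
      F dy_k gbar_ij = e^(2 phi) (W_;2 + 4 f W + 2 eps I W) m_i m_j m_k.

    Statements (i) and (ii) are then the same remark on a plane frame
    ([horizontal_C_frame]): if g = L L + k m m has Cartan tensor c m m m and
    d = a L + b m, then d_i C^i_jk is a nonzero multiple of c b m_j m_k.  For F
    one has d = phi_,1 l + phi_,2 m and c = I / F; for Fbar one has
    b = phi_,2 - phi_,1 f, and c vanishes exactly when
    I = (eps / 2) (ln rho - 4 phi)_;2.  In both cases c = 0 means that the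
    metric in question is Riemannian at the point.

    For (iii), the spray coefficients G^j of a metric F' are the only functions
    of degree 2 for which the derivatives delta_i annihilate F'^2
    ([metric_horizontal], [spray_unique]).  Since delta_i Fbar = Fbar delta_i phi
    when delta_i is that of F, the two sprays agree if and only if
    delta_i phi = 0 for every i ([same_spray_iff]).  If both sprays agree, both
    horizontality conditions are thus trivial.  Conversely, as neither metric is
    Riemannian on a non-empty open set, (i), (ii) and continuity give
    phi_,2 = 0 and phi_,2 = phi_,1 f everywhere, so that phi_,1 f = 0.  If
    delta_i phi were nonzero at some point it would be so on a neighbourhood,
    where f = 0; there phi depends on x only and its differential is
    proportional to l.  Differentiating this proportionality along the fibre
    makes the differential of phi vanish ([basic_factor_const]), a
    contradiction. *)

(** * Smooth functions on an open set *)

Section Calculus.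
Variables (R : realType) (V : normedModType R).
Implicit Types (f g : V -> R) (U : set V) (p v : V).

Lemma near_eq_differentiable f g p :
  (\forall q \near p, f q = g q) -> differentiable f p -> differentiable g p.
Proof.
move=> fg df.
have eqg : g \o shift p = cst (g p) + 'd f p +o_ (0 : V) id.
  apply/eqaddoP => _/posnumP[e].
  have /eqaddoP/(_ e%:num)/(_ [gt0 of e%:num]) fo := diff_locally df.
  rewrite -(nbhs_singleton fg).
  have fgs : \forall h \near (0 : V), f (h + p) = g (h + p).
    by move: fg; rewrite (near_shift 0) subr0.
  near=> h.
  rewrite (_ : (g \o _ - _) h = (f \o shift p - (cst (f p) + 'd f p)) h).
    by near: h.
  by rewrite !fctE /= (near fgs h).
apply/diff_locallyP.
have dfc := diff_continuous df.
by rewrite (diff_unique dfc eqg); split.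
Unshelve. all: by end_near. Qed.

Lemma open_eq_differentiable U f g p : open U -> {in U, f =1 g} -> U p ->
  differentiable f p -> differentiable g p.
Proof.
move=> oU fg Up; apply: near_eq_differentiable.
by near=> q; apply: fg; rewrite inE; near: q; exact: open_nbhs_nbhs.
Unshelve. all: by end_near. Qed.

Lemma open_eq_derive U f g p v : open U -> {in U, f =1 g} -> U p ->
  'D_v f p = 'D_v g p.
Proof.
move=> oU fg Up; apply: near_eq_derive.
by near=> q; apply: fg; rewrite inE; near: q; exact: open_nbhs_nbhs.
Unshelve. all: by end_near. Qed.

Lemma derive_add f g p v : differentiable f p -> differentiable g p ->
  'D_v (fun q => f q + g q) p = 'D_v f p + 'D_v g p.
Proof. by move=> df dg; apply: deriveD; exact: diff_derivable. Qed.

Lemma derive_sub f g p v : differentiable f p -> differentiable g p ->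
  'D_v (fun q => f q - g q) p = 'D_v f p - 'D_v g p.
Proof. by move=> df dg; apply: deriveB; exact: diff_derivable. Qed.

Lemma derive_mul f g p v : differentiable f p -> differentiable g p ->
  'D_v (fun q => f q * g q) p = 'D_v f p * g p + f p * 'D_v g p.
Proof.
move=> df dg; rewrite addrC [X in _ + X]mulrC.
by apply: deriveM; exact: diff_derivable.
Qed.

Lemma derive_inv f p v : f p != 0 -> differentiable f p ->
  'D_v (fun q => (f q)^-1) p = - (f p)^-1 ^+ 2 * 'D_v f p.
Proof.
by move=> f0 df; rewrite deriveV//; [rewrite exprVn|exact: diff_derivable].
Qed.

Lemma differentiable_expR f p : differentiable f p ->
  differentiable (fun q => expR (f q)) p.
Proof.
move=> df; apply: (differentiable_comp df).
exact/derivable1_diffP/derivable_expR.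
Qed.

Lemma derive_expRf f p v : differentiable f p ->
  'D_v (fun q => expR (f q)) p = expR (f p) * 'D_v f p.
Proof.
move=> df; have de : differentiable expR (f p).
  exact/derivable1_diffP/derivable_expR.
rewrite deriveE; last exact: differentiable_expR.
rewrite (diff_comp df de) /= (deriveE _ df); set t := 'd f p v.
rewrite -[t in LHS]mulr1 -[t * 1]/(t *: (1 : R)) linearZ /= -(deriveE _ de).
by have [_ ->] := is_derive_expR (f p); rewrite [LHS]mulrC.
Qed.

Lemma derive_sum2 (h : 'I_2 -> V -> R) p v : (forall i, differentiable (h i) p) ->
  'D_v (fun q => \sum_i h i q) p = \sum_i 'D_v (h i) p.
Proof.
move=> dh; rewrite (_ : (fun q => _) = \sum_i h i); last first.
  by apply/funext => q; rewrite fct_sumE.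
by rewrite derive_sum// => i; exact: diff_derivable.
Qed.

End Calculus.

Section Smooth.
Variables (R : realType) (V : normedModType R) (U : set V).
Hypothesis oU : open U.
Implicit Types (f g : V -> R) (p v : V).

(** [f] is differentiable on [U] together with its iterated directional
    derivatives of order at most [k]: the finite-order form of [smooth_on],
    on which closure properties can be proved by induction. *)
Fixpoint diff_upto (k : nat) f : Prop :=
  (forall p, U p -> differentiable f p) /\
  (if k is k'.+1 then forall v, diff_upto k' ('D_v f) else True).

Lemma diff_uptoW k f : diff_upto k.+1 f -> diff_upto k f.
Proof.
elim: k f => [|k IH] f [df Df]; first by split.
by split => // v; apply: IH; exact: Df.
Qed.

Lemma smooth_onP f : smooth_on U f <-> forall k, diff_upto k f.
Proof.
split => [sf k|cf s].
  suff: forall s, diff_upto k (foldr (fun v g => 'D_v g) f s) by move/(_ [::]).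
  elim: k => [|k IH] s; first by split=> // p; exact: sf.
  by split=> [p|v]; [exact: sf|exact: (IH (v :: s))].
suff: forall k, diff_upto k (foldr (fun v g => 'D_v g) f s).
  by move=> /(_ 0%N)[].
by elim: s => [//|v s IH] k /=; have [_] := IH k.+1; exact.
Qed.

Lemma eq_diff_upto k f g : {in U, f =1 g} -> diff_upto k f -> diff_upto k g.
Proof.
elim: k f g => [|k IH] f g fg [df Df].
  by split=> // p Up; apply: (open_eq_differentiable oU fg Up); exact: df.
split=> [p Up|v].
  by apply: (open_eq_differentiable oU fg Up); exact: df.
by apply: IH (Df v) => p /[1!inE] Up; exact: (open_eq_derive v oU fg Up).
Qed.

Lemma diff_upto_cst k (a : R) : diff_upto k (fun=> a).
Proof.
elim: k a => [|k IH] a; first by split=> // p _; exact: (differentiable_cst a).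
split=> [p _|v]; first exact: (differentiable_cst a).
by apply: eq_diff_upto (IH 0) => p _; rewrite [RHS]derive_cst.
Qed.

Lemma diff_uptoD k f g : diff_upto k f -> diff_upto k g ->
  diff_upto k (fun q => f q + g q).
Proof.
elim: k f g => [|k IH] f g [df Df] [dg Dg].
  by split=> // p Up; apply: differentiableD; [exact: df|exact: dg].
split=> [p Up|v]; first by apply: differentiableD; [exact: df|exact: dg].
apply: eq_diff_upto (IH _ _ (Df v) (Dg v)) => p /[1!inE] Up.
by rewrite derive_add//; [exact: df|exact: dg].
Qed.

Lemma diff_uptoM k f g : diff_upto k f -> diff_upto k g ->
  diff_upto k (fun q => f q * g q).
Proof.
elim: k f g => [|k IH] f g cf cg.
  by split=> // p Up; apply: differentiableM; [case: cf|case: cg] => d _; exact: d.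
have [[df Df] [dg Dg]] := (cf, cg).
split=> [p Up|v]; first by apply: differentiableM; [exact: df|exact: dg].
apply: eq_diff_upto (diff_uptoD (IH _ _ (Df v) (diff_uptoW cg))
  (IH _ _ (diff_uptoW cf) (Dg v))) => p /[1!inE] Up.
by rewrite derive_mul//; [exact: df|exact: dg].
Qed.

Lemma diff_uptoV k f : (forall p, U p -> f p != 0) -> diff_upto k f ->
  diff_upto k (fun q => (f q)^-1).
Proof.
move=> f0; elim: k => [|k IH] cf.
  by split=> // p Up; apply: differentiableV; [case: cf => d _; exact: d|exact: f0].
have [df Df] := cf.
split=> [p Up|v]; first by apply: differentiableV; [exact: df|exact: f0].
have ci := IH (diff_uptoW cf).
have cN : diff_upto k (fun=> -1) by exact: diff_upto_cst.
apply: eq_diff_upto (diff_uptoM (diff_uptoM cN (diff_uptoM ci ci)) (Df v)).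
move=> p /[1!inE] Up.
by rewrite derive_inv ?mulN1r ?expr2//; [exact: f0|exact: df].
Qed.

Lemma diff_upto_expR k f : diff_upto k f -> diff_upto k (fun q => expR (f q)).
Proof.
elim: k => [|k IH] cf.
  by split=> // p Up; apply: differentiable_expR; case: cf => d _; exact: d.
have [df Df] := cf.
split=> [p Up|v]; first by apply: differentiable_expR; exact: df.
apply: eq_diff_upto (diff_uptoM (IH (diff_uptoW cf)) (Df v)) => p /[1!inE] Up.
by rewrite derive_expRf//; exact: df.
Qed.

Lemma smooth_on_diff f p : smooth_on U f -> U p -> differentiable f p.
Proof. by move=> sf; exact: (sf [::]). Qed.

Lemma smooth_on_derive f v : smooth_on U f -> smooth_on U ('D_v f).
Proof.
by move=> /smooth_onP sf; apply/smooth_onP => k; have [_ Df] := sf k.+1; exact: Df.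
Qed.

Lemma eq_smooth_on f g : {in U, f =1 g} -> smooth_on U f -> smooth_on U g.
Proof.
move=> fg /smooth_onP sf; apply/smooth_onP => k; exact: eq_diff_upto (sf k).
Qed.

Lemma smooth_on_cst (a : R) : smooth_on U (fun=> a : R).
Proof. by apply/smooth_onP => k; exact: diff_upto_cst. Qed.

Lemma smooth_onD f g : smooth_on U f -> smooth_on U g ->
  smooth_on U (fun q => f q + g q).
Proof.
by move=> /smooth_onP ? /smooth_onP ?; apply/smooth_onP => k; exact: diff_uptoD.
Qed.

Lemma smooth_onM f g : smooth_on U f -> smooth_on U g ->
  smooth_on U (fun q => f q * g q).
Proof.
by move=> /smooth_onP ? /smooth_onP ?; apply/smooth_onP => k; exact: diff_uptoM.
Qed.

Lemma smooth_onB f g : smooth_on U f -> smooth_on U g ->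
  smooth_on U (fun q => f q - g q).
Proof.
move=> sf sg; apply: eq_smooth_on (smooth_onD sf (smooth_onM (smooth_on_cst (-1)) sg)).
by move=> p _; rewrite mulN1r.
Qed.

Lemma smooth_onX2 f : smooth_on U f -> smooth_on U (fun q => f q ^+ 2).
Proof. by move=> sf; rewrite /GRing.exp/=; exact: smooth_onM. Qed.

Lemma smooth_onV f : (forall p, U p -> f p != 0) -> smooth_on U f ->
  smooth_on U (fun q => (f q)^-1).
Proof.
by move=> ? /smooth_onP ?; apply/smooth_onP => k; exact: diff_uptoV.
Qed.

Lemma smooth_on_expR f : smooth_on U f -> smooth_on U (fun q => expR (f q)).
Proof.
by move=> /smooth_onP ?; apply/smooth_onP => k; exact: diff_upto_expR.
Qed.

Lemma smooth_on_sum2 (h : 'I_2 -> V -> R) : (forall i, smooth_on U (h i)) ->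
  smooth_on U (fun q => \sum_i h i q).
Proof.
move=> sh; apply: eq_smooth_on (smooth_onD (sh 0) (sh 1)) => p _.
by rewrite big_ord_recl big_ord1; congr (_ + h _ _); exact/val_inj.
Qed.

End Smooth.

(** * Symmetry of second derivatives *)

Section Schwarz.
Variables (R : realType) (V : normedModType R).
Implicit Types (f g : V -> R) (U : set V) (p u v : V).

Lemma is_derive_line g p u (t : R) : differentiable g (p + t *: u) ->
  is_derive t 1 (fun s : R => g (p + s *: u)) ('D_u g (p + t *: u)).
Proof.
move=> dg.
have dl : is_diff t (fun s : R => p + s *: u) (0 + ( *:%R^~ u)).
  exact: (is_diffD (is_diff_cst p t) (is_diff_scalel t u)).
have dc : is_diff t (fun s : R => g (p + s *: u))
    ('d g (p + t *: u) \o (0 + ( *:%R^~ u))).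
  exact: (is_diff_comp dl (differentiableP dg)).
apply: DeriveDef; first exact: diff_derivable.
by rewrite deriveE// diff_val deriveE//= fctE /= add0r scale1r.
Qed.

(** The mean value theorem on the segment from p to p + h u. *)
Lemma mean_value_line g p u (h : R) : 0 < h ->
  (forall t, 0 <= t <= h -> differentiable g (p + t *: u)) ->
  exists2 c, 0 <= c <= h &
    g (p + h *: u) - g p = 'D_u g (p + c *: u) * h.
Proof.
move=> h0 dg.
have [c| |c] := @MVT R (fun s => g (p + s *: u)) (fun s => 'D_u g (p + s *: u)) 0 h h0.
- rewrite in_itv/= => /andP[c0 ch]; apply: is_derive_line.
  by apply: dg; rewrite !ltW.
- apply: derivable_within_continuous => t; rewrite in_itv/= => t0h.
  by have [] := is_derive_line (dg t t0h).
rewrite in_itv/= => /andP[c0 ch] E; exists c; first by rewrite !ltW.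
by rewrite scale0r addr0 subr0 in E.
Qed.

(** The second difference of [f] on a parallelogram is a second derivative at
    some point of it; exchanging the two sides gives the symmetry below. *)
Lemma second_difference U f p u v (h : R) : open U -> smooth_on U f -> 0 < h ->
  (forall s t, 0 <= s <= h -> 0 <= t <= h -> U (p + s *: u + t *: v)) ->
  exists s t, [/\ 0 <= s <= h, 0 <= t <= h &
    f (p + h *: u + h *: v) - f (p + h *: u) - (f (p + h *: v) - f p)
    = 'D_v ('D_u f) (p + s *: u + t *: v) * h * h].
Proof.
move=> oU sf h0 pU.
have hh : 0 <= h <= h by rewrite lexx ltW.
have h00 : 0 <= (0 : R) <= h by rewrite lexx ltW.
have dh s : 0 <= s <= h -> differentiable (fun q => f (q + h *: v)) (p + s *: u).
  move=> s0h; apply: differentiable_comp => //=.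
  by apply: smooth_on_diff (pU _ _ s0h hh).
have d0 s : 0 <= s <= h -> differentiable f (p + s *: u).
  move=> s0h; apply: smooth_on_diff sf _.
  by have := pU _ _ s0h h00; rewrite scale0r addr0.
have [s s0h] := @mean_value_line (fun q => f (q + h *: v) - f q) p u h h0
  (fun s s0h => differentiableB (dh s s0h) (d0 s s0h)).
rewrite derive_sub; [|exact: dh|exact: d0].
have -> : 'D_u (fun q => f (q + h *: v)) (p + s *: u) = 'D_u f (p + s *: u + h *: v).
  rewrite /derive; set a := (fun t => _); set b := (fun t => _).
  by have -> : a = b by apply/funext => t; rewrite /a /b /= !addrA.
have [t t0h ->] := @mean_value_line ('D_u f) (p + s *: u) v h h0
  (fun t t0h => smooth_on_diff (smooth_on_derive u sf) (pU s t s0h t0h)).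
by move=> E; exists s, t; split.
Qed.

Lemma continuous_eq_at (A B : V -> R) p :
  {for p, continuous A} -> {for p, continuous B} ->
  (forall d, 0 < d -> exists x y, [/\ ball p d x, ball p d y & A x = B y]) ->
  A p = B p.
Proof.
move=> cA cB ABd; apply/eqP; rewrite -subr_eq0 -normr_eq0; apply/eqP.
apply/le_anti; rewrite normr_ge0 andbT; apply/ler_addgt0Pr => _/posnumP[e].
rewrite add0r.
have e2 : 0 < e%:num / 2 :> R by [].
have /cvgrPdist_lt/(_ _ e2)/nbhs_ballP[dA /= dA0 nA] := cA.
have /cvgrPdist_lt/(_ _ e2)/nbhs_ballP[dB /= dB0 nB] := cB.
have d0 : 0 < Num.min dA dB by rewrite lt_min dA0.
have [x [y [xd yd E]]] := ABd _ d0.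
have Ax : `|A p - A x| < e%:num / 2.
  by apply: nA; apply: le_ball xd; rewrite ge_min lexx.
have By : `|B p - B y| < e%:num / 2.
  by apply: nB; apply: le_ball yd; rewrite ge_min lexx orbT.
rewrite -(subrKA (A x)) {2}E (le_trans (ler_normD _ _))//.
by rewrite [leRHS]splitr lerD// ltW// distrC.
Qed.

Lemma schwarz U f p u v : open U -> smooth_on U f -> U p ->
  'D_u ('D_v f) p = 'D_v ('D_u f) p.
Proof.
move=> oU sf Up.
have cont w z : {for p, continuous ('D_w ('D_z f))}.
  apply: differentiable_continuous.
  exact: (smooth_on_diff (smooth_on_derive w (smooth_on_derive z sf)) Up).
apply: continuous_eq_at (cont _ _) (cont _ _) _ => d d0.
have /nbhs_ballP[r /= r0 rU] : nbhs p U by exact: open_nbhs_nbhs.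
pose e := Num.min d r.
have e0 : 0 < e by rewrite lt_min d0.
pose h := e / (2 * (`|u| + `|v| + 1)).
have uv0 : 0 < `|u| + `|v| + 1 by rewrite ltr_wpDl// addr_ge0.
have h0 : 0 < h by rewrite divr_gt0// mulr_gt0.
have inB s t : 0 <= s <= h -> 0 <= t <= h -> ball p e (p + s *: u + t *: v).
  move=> /andP[s0 sh] /andP[t0 th]; rewrite -ball_normE/=.
  rewrite -addrA opprD addrA subrr add0r normrN.
  rewrite (le_lt_trans (ler_normD _ _))// !normrZ !ger0_norm//.
  have : h * (`|u| + `|v| + 1) < e.
    by rewrite /h invfM mulrA mulfVK ?gt_eqF// ltr_pdivrMr// ltr_pMr// ltr1n.
  have := ler_wpM2r (normr_ge0 u) sh.
  have := ler_wpM2r (normr_ge0 v) th.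
  by move: (ltW h0); clearbody h; lra.
have er : e <= r by rewrite ge_min lexx orbT.
have ed : e <= d by rewrite ge_min lexx.
have inU s t : 0 <= s <= h -> 0 <= t <= h -> U (p + s *: u + t *: v).
  by move=> sh th; exact: (rU _ (le_ball er (inB s t sh th))).
have inU' s t : 0 <= s <= h -> 0 <= t <= h -> U (p + s *: v + t *: u).
  by move=> sh th; rewrite addrAC; exact: inU.
have [s [t [sh th E]]] := second_difference oU sf h0 inU.
have [s' [t' [sh' th' E']]] := second_difference oU sf h0 inU'.
exists (p + s' *: v + t' *: u), (p + s *: u + t *: v); split.
- by rewrite addrAC; exact: (le_ball ed (inB _ _ th' sh')).
- exact: (le_ball ed (inB _ _ sh th)).
apply: (mulIf (lt0r_neq0 h0)); apply: (mulIf (lt0r_neq0 h0)).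
apply: (etrans (esym E')); apply: etrans E.
rewrite [p + h *: v + h *: u]addrAC.
move: (f (p + h *: u + h *: v)) (f (p + h *: u)) (f (p + h *: v)) (f p).
by move=> a b c' d'; ring.
Qed.

End Schwarz.

(** * Fibre coordinates and homogeneity *)

(* Conversion tests that unfold derivatives are prohibitively slow, so here and
   below the heads of long expressions are made opaque. *)
#[local] Opaque derive.

Lemma sum2E (V : nmodType) (h : 'I_2 -> V) : \sum_i h i = h 0 + h 1.
Proof. by rewrite big_ord_recl big_ord1; congr (_ + h _); exact/val_inj. Qed.

(** Case analysis on an index in {0, 1}. *)
Lemma ord2P (P : 'I_2 -> Prop) : P 0 -> P 1 -> forall i, P i.
Proof.
move=> P0 P1 i; have [->//|->//] : i = 0 \/ i = 1.
by case: i => -[|[|//]] ?; [left|right]; exact/val_inj.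
Qed.

Section TangentCoordinates.
Variables (R : realType) (U : set (tcoord R)).
Hypothesis oU : open U.
Implicit Types (f g : tcoord R -> R) (p : tcoord R) (i j k : 'I_2).

Lemma derive_fiber_coord i p (v : tcoord R) :
  differentiable (fun q : tcoord R => q.2 0 i : R) p /\
  'D_v (fun q : tcoord R => q.2 0 i : R) p = v.2 0 i.
Proof.
have @L : {linear tcoord R -> R}.
  by exists (fun q : tcoord R => q.2 0 i); do 2![eexists]; do ?[constructor];
    rewrite ?mxE// => ? *; rewrite ?mxE//; move=> ?; rewrite !mxE.
have cL : continuous L.
  move=> q; apply: (@continuous_comp _ _ _ snd (fun y : 'rV[R]_2 => y 0 i)).
    exact: cvg_snd.
  exact: coord_continuous.
rewrite (_ : (fun _ => _) = L)//; split; first exact: linear_differentiable.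
by rewrite deriveE ?diff_lin//; exact: linear_differentiable.
Qed.

Lemma differentiable_y i p : differentiable (fun q : tcoord R => q.2 0 i : R) p.
Proof. by have [] := derive_fiber_coord i p 0. Qed.

Lemma dy_y i j p : dy j (fun q => q.2 0 i) p = (i == j)%:R.
Proof. by have [_ E] := derive_fiber_coord i p (0, delta_mx 0 j); rewrite /dy E mxE. Qed.

Lemma dx_y i j p : dx j (fun q => q.2 0 i) p = 0.
Proof. by have [_ E] := derive_fiber_coord i p (delta_mx 0 j, 0); rewrite /dx E mxE. Qed.

Lemma smooth_y i : smooth_on U (fun q => q.2 0 i : R).
Proof.
apply/smooth_onP => k; case: k => [|k]; first by split=> // p _; exact: differentiable_y.
split=> [p _|v]; first exact: differentiable_y.
apply: (eq_diff_upto oU _ (diff_upto_cst oU k (v.2 0 i))) => p _.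
by have [_ ->] := derive_fiber_coord i p v.
Qed.

Lemma smooth_dx i f : smooth_on U f -> smooth_on U (dx i f).
Proof. exact: smooth_on_derive. Qed.

Lemma smooth_dy i f : smooth_on U f -> smooth_on U (dy i f).
Proof. exact: smooth_on_derive. Qed.

Lemma dx_dy i j f p : smooth_on U f -> U p -> dx i (dy j f) p = dy j (dx i f) p.
Proof. by move=> sf Up; exact: (schwarz _ _ oU sf Up). Qed.

Lemma dy_dy i j f p : smooth_on U f -> U p -> dy i (dy j f) p = dy j (dy i f) p.
Proof. by move=> sf Up; exact: (schwarz _ _ oU sf Up). Qed.

Lemma eq_dy i f g p : {in U, f =1 g} -> U p -> dy i f p = dy i g p.
Proof. by move=> fg Up; exact: (open_eq_derive _ oU fg Up). Qed.

Lemma eq_dx i f g p : {in U, f =1 g} -> U p -> dx i f p = dx i g p.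
Proof. by move=> fg Up; exact: (open_eq_derive _ oU fg Up). Qed.

Lemma dyD i f g p : differentiable f p -> differentiable g p ->
  dy i (fun q => f q + g q) p = dy i f p + dy i g p.
Proof. exact: derive_add. Qed.

Lemma dyB i f g p : differentiable f p -> differentiable g p ->
  dy i (fun q => f q - g q) p = dy i f p - dy i g p.
Proof. exact: derive_sub. Qed.

Lemma dyM i f g p : differentiable f p -> differentiable g p ->
  dy i (fun q => f q * g q) p = dy i f p * g p + f p * dy i g p.
Proof. exact: derive_mul. Qed.

Lemma dxM i f g p : differentiable f p -> differentiable g p ->
  dx i (fun q => f q * g q) p = dx i f p * g p + f p * dx i g p.
Proof. exact: derive_mul. Qed.

Lemma dyZ i (a : R) f p : differentiable f p ->
  dy i (fun q => a * f q) p = a * dy i f p.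
Proof.
move=> df; rewrite dyM//.
by rewrite /dy (derive_cst a) mul0r add0r.
Qed.

Lemma dxZ i (a : R) f p : differentiable f p ->
  dx i (fun q => a * f q) p = a * dx i f p.
Proof.
move=> df; rewrite dxM//.
by rewrite /dx (derive_cst a) mul0r add0r.
Qed.

Lemma dyX2 i f p : differentiable f p ->
  dy i (fun q => f q ^+ 2) p = 2 * (f p * dy i f p).
Proof. by move=> df; rewrite [LHS](dyM i df df); ring. Qed.

Lemma dxX2 i f p : differentiable f p ->
  dx i (fun q => f q ^+ 2) p = 2 * (f p * dx i f p).
Proof. by move=> df; rewrite [LHS](dxM i df df); ring. Qed.

Lemma dy_expR i f p : differentiable f p ->
  dy i (fun q => expR (f q)) p = expR (f p) * dy i f p.
Proof. exact: derive_expRf. Qed.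

Lemma dx_expR i f p : differentiable f p ->
  dx i (fun q => expR (f q)) p = expR (f p) * dx i f p.
Proof. exact: derive_expRf. Qed.

Lemma dy_sum i (h : 'I_2 -> tcoord R -> R) p : (forall j, differentiable (h j) p) ->
  dy i (fun q => \sum_j h j q) p = \sum_j dy i (h j) p.
Proof. exact: derive_sum2. Qed.

Lemma dx_sum i (h : 'I_2 -> tcoord R -> R) p : (forall j, differentiable (h j) p) ->
  dx i (fun q => \sum_j h j q) p = \sum_j dx i (h j) p.
Proof. exact: derive_sum2. Qed.

#[local] Opaque dx dy.

Lemma dy_fiber_sum (h : 'I_2 -> tcoord R -> R) j p :
  (forall r, differentiable (h r) p) ->
  dy j (fun q : tcoord R => \sum_r q.2 0 r * h r q) p =
  h j p + \sum_r p.2 0 r * dy j (h r) p.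
Proof.
move=> dh.
have dY r : differentiable (fun q : tcoord R => q.2 0 r * h r q) p.
  by apply: differentiableM; [exact: differentiable_y|exact: dh].
rewrite (dy_sum _ dY).
have E r : dy j (fun q : tcoord R => q.2 0 r * h r q) p =
    (r == j)%:R * h r p + p.2 0 r * dy j (h r) p.
  by rewrite (dyM j (differentiable_y r p) (dh r)) dy_y.
rewrite (eq_bigr _ (fun r _ => E r)) big_split /=; congr (_ + _).
by rewrite (bigD1 j)//= eqxx mul1r big1 ?addr0// => i /negPf->; rewrite mul0r.
Qed.

(** The Liouville (radial) vector field y^i dy_i applied to [f]. *)
Definition radial f p : R := \sum_i p.2 0 i * dy i f p.

Lemma derive_radial f p : differentiable f p -> 'D_((0 : 'rV[R]_2), p.2) f p = radial f p.
Proof.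
move=> df; rewrite deriveE// /radial.
have -> : ((0 : 'rV[R]_2), p.2) = \sum_i p.2 0 i *: (0, delta_mx 0 i) :> tcoord R.
  rewrite {1}[p.2]row_sum_delta sum2E [in RHS]sum2E.
  by apply/eqP; rewrite -pair_eqE /pair_eq /= !scaler0 addr0 !eqxx.
rewrite linear_sum; apply: eq_bigr => i _.
by rewrite linearZ/= -deriveE.
Qed.

(** Euler's relation y^i dy_i f = r f on [U], the infinitesimal form of
    positive homogeneity of degree [r] in y. *)
Definition euler (r : R) f : Prop := forall p, U p -> radial f p = r * f p.

Lemma homogeneous_euler (n : nat) f :
  (forall p (t : R), U p -> 0 < t -> f (p.1, t *: p.2) = t ^+ n * f p) ->
  (forall p, U p -> differentiable f p) -> euler n%:R f.
Proof.
move=> hf df p Up; rewrite -derive_radial; last exact: df.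
set w : tcoord R := (0, p.2).
have df0 : differentiable f (p + 0 *: w) by rewrite scale0r addr0; exact: df.
have [_ E] := is_derive_line df0.
have -> : 'D_w f p = 'D_1 (fun s : R => f (p + s *: w)) 0.
  by rewrite E scale0r addr0.
have near0 : \forall s \near (0 : R), (1 + s) ^+ n * f p = f (p + s *: w).
  have : \forall s \near (0 : R), -1 < s by apply: lt_nbhsr; rewrite ltrN10.
  apply: filterS => s s1; rewrite -hf//; last by rewrite -ltrBlDl sub0r.
  congr f; apply/eqP; rewrite -pair_eqE /pair_eq /=.
  by rewrite scaler0 addr0 scalerDl scale1r !eqxx.
rewrite -(near_eq_derive _ near0).
rewrite (_ : (fun s : R => _) = (cst 1 + id) ^+ n * cst (f p)); last first.
  by apply/funext => s; rewrite !fctE.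
have [_ ->] := is_deriveM (is_deriveX n (is_deriveD
  (is_derive_cst (1 : R) (0 : R) (1 : R)) (is_derive_id (0 : R) (1 : R))))
  (is_derive_cst (f p) (0 : R) (1 : R)).
rewrite scaler0 !add0r !fctE addr0 expr1n mulr1.
by rewrite /cst [LHS]mulrC [_ *: 1]mulr1.
Qed.

Lemma dy_radial f j p : smooth_on U f -> U p ->
  dy j (radial f) p = dy j f p + radial (dy j f) p.
Proof.
move=> sf Up.
have dd i : differentiable (dy i f) p by exact: smooth_on_diff (smooth_dy i sf) Up.
apply: (etrans (dy_fiber_sum j dd)); apply: (congr1 (fun a => dy j f p + a)).
apply: eq_bigr => i _.
exact: (congr1 (fun a => p.2 0 i * a) (dy_dy j i sf Up)).
Qed.

Lemma dx_radial f j p : smooth_on U f -> U p ->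
  dx j (radial f) p = radial (dx j f) p.
Proof.
move=> sf Up.
have dd i : differentiable (dy i f) p by exact: smooth_on_diff (smooth_dy i sf) Up.
have dY i : differentiable (fun q : tcoord R => q.2 0 i * dy i f q) p.
  by apply: differentiableM; [exact: differentiable_y|exact: dd].
rewrite /radial (dx_sum _ dY); apply: eq_bigr => i _.
by rewrite (dxM j (differentiable_y i p) (dd i)) dx_y (dx_dy j i sf Up) mul0r add0r.
Qed.

Lemma euler_dy r f j : smooth_on U f -> euler r f -> euler (r - 1) (dy j f).
Proof.
move=> sf ef p Up; have df := smooth_on_diff sf Up.
have E : dy j (radial f) p = dy j (fun q => r * f q) p.
  by apply: eq_dy Up => q /[1!inE]; exact: ef.
rewrite (dy_radial j sf Up) (dyZ j r df) in E.
by rewrite mulrBl mul1r -E addrAC subrr add0r.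
Qed.

Lemma euler_dx r f j : smooth_on U f -> euler r f -> euler r (dx j f).
Proof.
move=> sf ef p Up; have df := smooth_on_diff sf Up.
have E : dx j (radial f) p = dx j (fun q => r * f q) p.
  by apply: eq_dx Up => q /[1!inE]; exact: ef.
by rewrite (dx_radial j sf Up) (dxZ j r df) in E.
Qed.

Lemma radialM f g p : differentiable f p -> differentiable g p ->
  radial (fun q => f q * g q) p = radial f p * g p + f p * radial g p.
Proof.
move=> df dg; rewrite /radial mulr_suml mulr_sumr -big_split /=.
by apply: eq_bigr => i _; rewrite (dyM i df dg); ring.
Qed.

Lemma radialB f g p : differentiable f p -> differentiable g p ->
  radial (fun q => f q - g q) p = radial f p - radial g p.
Proof.
move=> df dg; rewrite /radial -sumrB.
by apply: eq_bigr => i _; rewrite (dyB i df dg) mulrBr.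
Qed.

Lemma radialZ (a : R) f p : differentiable f p ->
  radial (fun q => a * f q) p = a * radial f p.
Proof.
move=> df; rewrite /radial mulr_sumr.
by apply: eq_bigr => i _; rewrite (dyZ i a df) mulrCA.
Qed.

Lemma radial_sum (h : 'I_2 -> tcoord R -> R) p : (forall j, differentiable (h j) p) ->
  radial (fun q => \sum_j h j q) p = \sum_j radial (h j) p.
Proof.
move=> dh; rewrite /radial exchange_big /=; apply: eq_bigr => i _.
by rewrite (dy_sum i dh) mulr_sumr.
Qed.

Lemma radial_y i p : radial (fun q => q.2 0 i) p = p.2 0 i.
Proof.
rewrite /radial (bigD1 i)//= dy_y eqxx mulr1 big1 ?addr0// => j /negPf ij.
by rewrite dy_y eq_sym ij mulr0.
Qed.

Lemma eq_radial f g p : {in U, f =1 g} -> U p -> radial f p = radial g p.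
Proof. by move=> fg Up; rewrite /radial; apply: eq_bigr => i _; rewrite (eq_dy _ fg Up). Qed.

End TangentCoordinates.

(** * Linear algebra of a plane frame *)

Section Plane.
Variable K : fieldType.
Implicit Types (G : 'M[K]_2) (L m d X : 'I_2 -> K).

Lemma det2E G : \det G = G 0 0 * G 1 1 - G 0 1 * G 1 0.
Proof.
rewrite (expand_det_row _ 0) sum2E /cofactor !det_mx11 !mxE /= expr0 expr1.
have -> : lift (0 : 'I_2) (0 : 'I_1) = 1 by exact/val_inj.
have -> : lift (1 : 'I_2) (0 : 'I_1) = 0 by exact/val_inj.
by rewrite mul1r mulN1r mulrN.
Qed.

Lemma invmx2E G : G \in unitmx ->
  [/\ invmx G 0 0 = (\det G)^-1 * G 1 1, invmx G 0 1 = - ((\det G)^-1 * G 0 1),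
      invmx G 1 0 = - ((\det G)^-1 * G 1 0) & invmx G 1 1 = (\det G)^-1 * G 0 0].
Proof.
move=> uG.
have l0 : lift (0 : 'I_2) (0 : 'I_1) = 1 by exact/val_inj.
have l1 : lift (1 : 'I_2) (0 : 'I_1) = 0 by exact/val_inj.
rewrite /invmx uG !mxE /cofactor !det_mx11 !mxE l0 l1 /=.
by split; ring.
Qed.

Lemma invmx2_apply G (u v : 'I_2 -> K) i : G \in unitmx ->
  (forall j, \sum_k G j k * v k = u j) -> \sum_k invmx G i k * u k = v i.
Proof.
move=> uG Gv.
have E : G *m (\col_k v k) = \col_k u k.
  by apply/colP => j; rewrite !mxE -Gv; apply: eq_bigr => k _; rewrite mxE.
have := congr1 (fun A : 'cV_2 => A i 0) (mulKmx uG (\col_k v k)).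
by rewrite E !mxE => <-; apply: eq_bigr => k _; rewrite mxE.
Qed.

Lemma frame_unit G L m (k : K) : G \in unitmx ->
  (forall i j, G i j = L i * L j + k * (m i * m j)) ->
  k != 0 /\ L 0 * m 1 - L 1 * m 0 != 0.
Proof.
rewrite unitmxE unitfE det2E => dG GE; apply/andP; move: dG; rewrite !GE.
apply: contraNT; rewrite negb_and !negbK => /orP[/eqP->|/eqP E]; first by apply/eqP; ring.
apply/eqP.
have -> : (L 0 * L 0 + k * (m 0 * m 0)) * (L 1 * L 1 + k * (m 1 * m 1)) -
  (L 0 * L 1 + k * (m 0 * m 1)) * (L 1 * L 0 + k * (m 1 * m 0)) =
  k * (L 0 * m 1 - L 1 * m 0) ^+ 2 by ring.
by rewrite E expr0n mulr0.
Qed.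

(** For g = L L + k m m, the vector g^{-1} m is (- L_1, L_0) / (k D) with
    D = L_0 m_1 - L_1 m_0, so that pairing it with a L + b m gives b / k. *)
Lemma frame_inv_apply G L m (k a b : K) d : G \in unitmx ->
  (forall i j, G i j = L i * L j + k * (m i * m j)) ->
  (forall i, d i = a * L i + b * m i) ->
  \sum_i d i * (\sum_j invmx G i j * m j) = b / k.
Proof.
move=> uG GE dE; have [k0 D0] := frame_unit uG GE.
pose v (i : 'I_2) := (if i == 0 then - L 1 else L 0) / (k * (L 0 * m 1 - L 1 * m 0)).
have GV j : \sum_i G j i * v i = m j.
  by rewrite sum2E !GE /v /=; move: j; apply: ord2P; field; rewrite k0 D0.
rewrite sum2E !(invmx2_apply _ uG GV) /v !dE /=.
by field; rewrite k0 D0.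
Qed.

Lemma frame_free L m (a b : K) : L 0 * m 1 - L 1 * m 0 != 0 ->
  (forall i, a * L i + b * m i = 0) -> a = 0 /\ b = 0.
Proof.
move=> D0 E; split; apply: (mulIf D0); rewrite mul0r.
  have -> : a * (L 0 * m 1 - L 1 * m 0) =
    m 1 * (a * L 0 + b * m 0) - m 0 * (a * L 1 + b * m 1) by ring.
  by rewrite !E !mulr0 subrr.
have -> : b * (L 0 * m 1 - L 1 * m 0) =
    L 0 * (a * L 1 + b * m 1) - L 1 * (a * L 0 + b * m 0) by ring.
by rewrite !E !mulr0 subrr.
Qed.

Lemma frame_vec_neq0 L m : L 0 * m 1 - L 1 * m 0 != 0 -> exists i, m i != 0.
Proof.
move=> D0; have [m0|m0] := eqVneq (m 0) 0; last by exists 0.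
by exists 1; apply: contraNneq D0 => m1; rewrite m0 m1 !mulr0 subrr.
Qed.

Lemma sym_tensor_eq0 X m : (2 : K) != 0 -> (exists i, m i != 0) ->
  (forall i j, X i * m j + m i * X j = 0) -> forall i, X i = 0.
Proof.
move=> two [i mi0] E j.
have Xi : X i = 0.
  apply: (mulIf mi0); apply: (mulfI two); rewrite mul0r mulr0 -(E i i); ring.
apply: (mulfI mi0); rewrite mulr0 -(E i j) Xi; ring.
Qed.

End Plane.

(* A fundamental metric with a frame whose Cartan tensor is c m m m *)
(** If the fundamental tensor of F' is L L + k m m, its Cartan tensor is
    c m m m, and delta phi = a L + b m, then delta_i phi C^i_jk equals
    (c b / k) m_j m_k. *)
Lemma horizontal_C_frame (R : realType) (F F' phi : tcoord R -> R) p
    (L m : 'I_2 -> R) (k a b c : R) :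
  gmx F' p \in unitmx ->
  (forall i j, gmx F' p i j = L i * L j + k * (m i * m j)) ->
  (forall i j l, cartan F' i j l p = c * (m i * m j * m l)) ->
  (forall i, hdelta F i phi p = a * L i + b * m i) ->
  (horizontal_C_at F F' phi p <-> c = 0 \/ b = 0) /\
  (riemannian_at F' p <-> c = 0).
Proof.
move=> uG GE CE dE; have [k0 D0] := frame_unit uG GE.
have [i mi0] := frame_vec_neq0 D0.
have two : (2 : R) != 0 by rewrite pnatr_eq0.
have two' : (2^-1 : R) != 0 by rewrite invr_eq0.
have HE j l : \sum_i hdelta F i phi p * cartan_up F' i j l p =
    c * (m j * m l) * (b / k).
  rewrite -(frame_inv_apply uG GE dE) mulr_sumr; apply: eq_bigr => r _.
  rewrite /cartan_up mulrCA; congr (_ * _); rewrite mulr_sumr.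
  by apply: eq_bigr => s _; rewrite CE /ginv; ring.
split; split.
- move=> /(_ i i); rewrite HE => /eqP.
  rewrite !mulf_eq0 (negPf mi0) !orbF invr_eq0 (negPf k0) orbF.
  by move=> /orP[/eqP|/eqP]; [left|right].
- by case=> E j l; rewrite HE E; ring.
- move=> /(_ i i i) E; have := CE i i i.
  rewrite /cartan E mulr0 => /esym/eqP.
  by rewrite !mulf_eq0 (negPf mi0) !orbF => /eqP.
- move=> E j l r; apply: (mulfI two'); rewrite mulr0.
  by have := CE j l r; rewrite /cartan E mul0r.
Qed.

(** * The Berwald frame of a metric *)

(** Abstracts derivatives, frame components and matrix entries before a call to
    [ring] or [field], which would otherwise compare them by unfolding. *)
Ltac atoms := repeat match goal with
  | |- context [dy ?i ?f ?p] => generalize (dy i f p); intro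
  | |- context [dx ?i ?f ?p] => generalize (dx i f p); intro
  | |- context [vder2 ?F ?m ?f ?p] => generalize (vder2 F m f p); intro
  | |- context [hder1 ?F ?m ?f ?p] => generalize (hder1 F m f p); intro
  | |- context [hder2 ?F ?m ?f ?p] => generalize (hder2 F m f p); intro
  | |- context [hdelta ?F ?i ?f ?p] => generalize (hdelta F i f p); intro
  | |- context [@fun_of_matrix ?R ?n ?k ?A ?i ?j] =>
      generalize (@fun_of_matrix R n k A i j); intro
  end.
Ltac dring := atoms; ring.

(** If y annihilates m and d, but not l, then d is a multiple of m. *)
Lemma frame_coef_eq0 (K : fieldType) (F y0 y1 l0 l1 m0 m1 d0 d1 a v : K) :
  F != 0 -> y0 * l0 + y1 * l1 = F -> y0 * m0 + y1 * m1 = 0 ->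
  y0 * d0 + y1 * d1 = 0 -> F * d0 = a * l0 + v * m0 ->
  F * d1 = a * l1 + v * m1 -> a = 0.
Proof.
move=> F0 yl ym yd E0 E1; apply: (mulIf F0); rewrite mul0r -[in LHS]yl.
have -> : a * (y0 * l0 + y1 * l1) = y0 * (a * l0 + v * m0) +
  y1 * (a * l1 + v * m1) - v * (y0 * m0 + y1 * m1) by ring.
rewrite -E0 -E1 ym mulr0 subr0.
have -> : y0 * (F * d0) + y1 * (F * d1) = F * (y0 * d0 + y1 * d1) by ring.
by rewrite yd mulr0.
Qed.

Section Metric.
Variables (R : realType) (U : set (tcoord R)) (F : tcoord R -> R).
Hypothesis oU : open U.
Hypothesis U0 : forall p, U p -> p.2 != 0.
Hypothesis sF : smooth_on U F.
Hypothesis eF : euler U 1 F.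
Hypothesis gU : forall p, U p -> gmx F p \in unitmx.
Implicit Types (p : tcoord R) (i j k : 'I_2).

Let dF p : U p -> differentiable F p.
Proof. by move=> Up; exact: (smooth_on_diff sF Up). Qed.

Let ddF j p : U p -> differentiable (dy j F) p.
Proof. by move=> Up; exact: (smooth_on_diff (smooth_dy j sF) Up). Qed.

Lemma gmxE p i j : U p ->
  gmx F p i j = dy i F p * dy j F p + F p * dy i (dy j F) p.
Proof.
move=> Up; rewrite mxE.
have E : {in U, dy j (fun q => F q ^+ 2) =1 (fun q => 2 * (F q * dy j F q))}.
  by move=> q /[1!inE] Uq; rewrite (dyX2 j (dF Uq)).
rewrite (eq_dy oU i E Up) dyZ; last by apply: differentiableM; [exact: dF|exact: ddF].
by rewrite (dyM i (dF Up) (ddF j Up)) mulKf ?pnatr_eq0.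
Qed.

#[local] Opaque gmx.

Lemma radial_metric p : U p -> radial F p = F p.
Proof. by move=> Up; rewrite (eF Up) mul1r. Qed.

Lemma radial_dy_metric j p : U p -> radial (dy j F) p = 0.
Proof. by move=> Up; rewrite (euler_dy oU j sF eF Up) subrr mul0r. Qed.

(** y^i g_ij = F l_j, hence F vanishes nowhere, g being invertible. *)
Lemma gmx_radial p j : U p -> \sum_i p.2 0 i * gmx F p i j = F p * dy j F p.
Proof.
move=> Up; have r1 := radial_metric Up; have r2 := radial_dy_metric j Up.
rewrite (eq_bigr _ (fun i _ => congr1 (fun a => p.2 0 i * a) (gmxE i j Up))).
rewrite /radial !sum2E in r1 r2 *.
move: r1 r2; atoms => r1 r2; rewrite -[in RHS]r1 -[RHS]addr0 -[in RHS](mulr0 (F p)) -[in RHS]r2.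
by ring.
Qed.

Lemma metric_neq0 p : U p -> F p != 0.
Proof.
move=> Up; apply: contraNneq (U0 Up) => F0.
have yg : p.2 *m gmx F p = 0.
  apply/rowP => j; rewrite mxE (gmx_radial j Up) F0 mul0r.
  by rewrite mxE.
by rewrite -(mulmxK (gU Up) p.2) yg mul0mx.
Qed.

Section Frame.
Variables (eps : R) (m : tcoord R -> 'rV[R]_2) (Is : tcoord R -> R).
Hypothesis eps2 : eps * eps = 1.
Hypothesis dm : forall p i, U p -> differentiable (fun q => m q 0 i) p.
Hypothesis gE : forall p, U p -> forall i j,
  gmx F p i j = ell F p 0 i * ell F p 0 j + eps * (m p 0 i * m p 0 j).
Hypothesis hI : forall p, U p -> forall i j k,
  F p * cartan F i j k p = Is p * m p 0 i * m p 0 j * m p 0 k.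

Let gE' p : U p -> forall i j,
  gmx F p i j = dy i F p * dy j F p + eps * (m p 0 i * m p 0 j).
Proof. by move=> Up i j; rewrite (gE Up i j) /ell !mxE. Qed.

Lemma eps_neq0 : eps != 0.
Proof. by apply: contra_eq_neq eps2 => ->; rewrite mul0r eq_sym oner_eq0. Qed.

Lemma frame_det p : U p -> dy 0 F p * m p 0 1 - dy 1 F p * m p 0 0 != 0.
Proof.
by move=> Up; have [] := @frame_unit _ _ (fun i => dy i F p) (m p 0) _ (gU Up) (gE' Up).
Qed.

Lemma frame_neq0 p : U p -> exists i, m p 0 i != 0.
Proof.
by move=> Up; exact: (@frame_vec_neq0 _ (fun i => dy i F p) (m p 0) (frame_det Up)).
Qed.

Lemma frame_radial p : U p -> \sum_i p.2 0 i * m p 0 i = 0.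
Proof.
move=> Up; have [j mj] := frame_neq0 Up.
apply: (mulIf mj); apply: (mulfI eps_neq0).
have := gmx_radial j Up; have := radial_metric Up.
rewrite /radial !sum2E (gE' Up 0 j) (gE' Up 1 j).
move: (dy 0 F p) (dy 1 F p) (dy j F p) (F p) => l0 l1 lj f <- E.
rewrite mul0r mulr0 -(subrr ((p.2 0 0 * l0 + p.2 0 1 * l1) * lj)) -{1}E.
by dring.
Qed.

(** The angular metric: F dy_i l_j = g_ij - l_i l_j = eps m_i m_j. *)
Lemma dydy_metric p i j : U p -> F p * dy i (dy j F) p = eps * (m p 0 i * m p 0 j).
Proof.
move=> Up; have := gE' Up i j; rewrite (gmxE i j Up) => E.
exact: (addrI _ E).
Qed.

Lemma cartan_frame p i j k : U p ->
  cartan F i j k p = (Is p / F p) * (m p 0 i * m p 0 j * m p 0 k).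
Proof.
move=> Up; apply: (mulfI (metric_neq0 Up)); rewrite hI//.
by field; exact: metric_neq0.
Qed.

(** Differentiating g_ij = l_i l_j + eps m_i m_j determines the symmetric product
    of m with the derivative of m, hence that derivative. *)
Lemma dy_frame p i k : U p -> F p * dy k (fun q => m q 0 i) p =
  - (dy i F p - eps * Is p * m p 0 i) * m p 0 k.
Proof.
move=> Up; apply/eqP; rewrite -subr_eq0; apply/eqP.
move: i; apply: (@sym_tensor_eq0 _ _ (m p 0)); first by rewrite pnatr_eq0.
  exact: frame_neq0.
move=> i j; have F0 := metric_neq0 Up.
have E : {in U, (fun q => gmx F q i j) =1
    (fun q => dy i F q * dy j F q + eps * (m q 0 i * m q 0 j))}.
  by move=> q /[1!inE] Uq; exact: gE'.
have dl : differentiable (fun q => dy i F q * dy j F q) p.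
  by apply: differentiableM; exact: ddF.
have dmm : differentiable (fun q => m q 0 i * m q 0 j) p.
  by apply: differentiableM; exact: dm.
have demm : differentiable (fun q => eps * (m q 0 i * m q 0 j)) p.
  by apply: differentiableM.
have C := hI Up i j k.
rewrite /cartan (eq_dy oU k E Up) (dyD k dl demm) (dyZ k eps dmm) in C.
rewrite (dyM k (ddF i Up) (ddF j Up)) (dyM k (dm i Up) (dm j Up)) in C.
have Ei := dydy_metric k i Up; have Ej := dydy_metric k j Up.
set mki := dy k (fun q => m q 0 i) p in C *.
set mkj := dy k (fun q => m q 0 j) p in C *.
move: C Ei Ej; move: mki mkj => mki mkj.
generalize (dy k (dy i F) p) (dy k (dy j F) p) (dy i F p) (dy j F p).
move=> lki lkj li lj C Ei Ej.
have {}C : eps * (F p * mki * m p 0 j + m p 0 i * (F p * mkj)) =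
  2 * (Is p * m p 0 i * m p 0 j * m p 0 k) - (F p * lki) * lj - li * (F p * lkj).
  by rewrite -C; atoms; field.
rewrite Ei Ej in C; apply: (mulfI eps_neq0); rewrite mulr0.
have -> : eps * ((F p * mki - - (li - eps * Is p * m p 0 i) * m p 0 k) * m p 0 j +
   m p 0 i * (F p * mkj - - (lj - eps * Is p * m p 0 j) * m p 0 k)) =
   eps * (F p * mki * m p 0 j + m p 0 i * (F p * mkj)) +
   eps * (m p 0 k * m p 0 i) * lj + li * (eps * (m p 0 k * m p 0 j))
   - eps * eps * (2 * (Is p * m p 0 i * m p 0 j * m p 0 k)) by dring.
by rewrite C eps2; dring.
Qed.

Lemma frame_decomp p (w : 'rV[R]_2) i : U p ->
  w 0 i = frame_coord F m p w 0 0 * dy i F p + frame_coord F m p w 0 1 * m p 0 i.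
Proof.
by move=> Up; rewrite {1}(frame_coordP w (gU Up) (gE Up)) !mxE.
Qed.

Lemma hdelta_frame p f i : U p ->
  hdelta F i f p = hder1 F m f p * dy i F p + hder2 F m f p * m p 0 i.
Proof. by move=> Up; rewrite -(frame_decomp _ _ Up) mxE. Qed.

Lemma vder2_unique p f b : U p -> (forall i, F p * dy i f p = b * m p 0 i) ->
  vder2 F m f p = b.
Proof.
move=> Up E; apply/eqP; rewrite -subr_eq0; apply/eqP.
have [] := @frame_free _ (fun i => dy i F p) (m p 0)
  (frame_coord F m p (\row_i (F p * dy i f p)) 0 0) (vder2 F m f p - b) (frame_det Up) _ => //.
move=> i; rewrite mulrBl addrA -(frame_decomp _ _ Up) mxE E; exact: subrr.
Qed.

(** For [f] of degree 0 the ell-component f_;1 is zero. *)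
Lemma vder2P p f i : U p -> radial f p = 0 ->
  F p * dy i f p = vder2 F m f p * m p 0 i.
Proof.
move=> Up rf; have F0 := metric_neq0 Up.
have E k : F p * dy k f p =
    frame_coord F m p (\row_i (F p * dy i f p)) 0 0 * dy k F p +
    vder2 F m f p * m p 0 k.
  by rewrite -(frame_decomp _ _ Up) mxE.
have a0 : frame_coord F m p (\row_i (F p * dy i f p)) 0 0 = 0.
  have r1 := radial_metric Up; have r2 := frame_radial Up.
  rewrite /radial !sum2E in r1 r2 rf.
  exact: frame_coef_eq0 F0 r1 r2 rf (E 0) (E 1).
by rewrite E a0 mul0r add0r.
Qed.

Lemma horizontal_C_metric f p : U p ->
  horizontal_C_at F F f p <-> riemannian_at F p \/ hder2 F m f p = 0.
Proof.
move=> Up; have [-> ->] := horizontal_C_frame (gU Up) (gE' Up)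
  (fun i j k => cartan_frame i j k Up) (fun i => hdelta_frame f i Up).
by [].
Qed.

End Frame.
End Metric.

(** * The changed metric *)

#[local] Opaque vder2 hder1 hder2 hdelta expR.

Lemma frame_unitmx (K : fieldType) (G : 'M[K]_2) (L m : 'I_2 -> K) (k : K) :
  (forall i j, G i j = L i * L j + k * (m i * m j)) ->
  k != 0 -> L 0 * m 1 - L 1 * m 0 != 0 -> G \in unitmx.
Proof.
move=> GE k0 D0; rewrite unitmxE unitfE det2E !GE.
have -> : (L 0 * L 0 + k * (m 0 * m 0)) * (L 1 * L 1 + k * (m 1 * m 1)) -
  (L 0 * L 1 + k * (m 0 * m 1)) * (L 1 * L 0 + k * (m 1 * m 0)) =
  k * (L 0 * m 1 - L 1 * m 0) ^+ 2 by ring.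
by rewrite mulf_neq0// expf_neq0.
Qed.

Lemma sumsq_neq0 (K : realFieldType) (m : 'I_2 -> K) :
  (exists i, m i != 0) -> m 0 * m 0 + m 1 * m 1 != 0.
Proof.
move=> [i mi]; have : m 0 != 0 \/ m 1 != 0.
  by move: i mi; apply: ord2P => h; [left|right].
rewrite -!expr2 => -[] h; apply: lt0r_neq0.
  by rewrite ltr_wpDr ?sqr_ge0// lt_neqAle sqr_ge0 eq_sym sqrf_eq0 h.
by rewrite ltr_wpDl ?sqr_ge0// lt_neqAle sqr_ge0 eq_sym sqrf_eq0 h.
Qed.

Section Change.
Variables (R : realType) (U : set (tcoord R)) (F phi : tcoord R -> R).
Variables (eps : R) (m : tcoord R -> 'rV[R]_2) (Is : tcoord R -> R).
Hypothesis oU : open U.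
Hypothesis U0 : forall p, U p -> p.2 != 0.
Hypothesis sF : smooth_on U F.
Hypothesis eF : euler U 1 F.
Hypothesis gU : forall p, U p -> gmx F p \in unitmx.
Hypothesis eps2 : eps * eps = 1.
Hypothesis dm : forall p i, U p -> differentiable (fun q => m q 0 i) p.
Hypothesis gE : forall p, U p -> forall i j,
  gmx F p i j = ell F p 0 i * ell F p 0 j + eps * (m p 0 i * m p 0 j).
Hypothesis hI : forall p, U p -> forall i j k,
  F p * cartan F i j k p = Is p * m p 0 i * m p 0 j * m p 0 k.
Hypothesis sphi : smooth_on U phi.
Hypothesis ephi : euler U 0 phi.

Let f := vder2 F m phi.
(* W = 1 / rho, and L_i is e^(- phi) times the i-th fibre derivative of Fbar. *)
Let W (p : tcoord R) : R := sigma eps F m Is phi p + eps - f p ^+ 2.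
Let L i (p : tcoord R) : R := dy i F p + f p * m p 0 i.
Hypothesis hW : forall p, U p -> W p != 0.
Let Fb := change F phi.

Let dF p : U p -> differentiable F p.
Proof. by move=> Up; exact: (smooth_on_diff sF Up). Qed.

Let ddF j p : U p -> differentiable (dy j F) p.
Proof. by move=> Up; exact: (smooth_on_diff (smooth_dy j sF) Up). Qed.

Let dphi p : U p -> differentiable phi p.
Proof. by move=> Up; exact: (smooth_on_diff sphi Up). Qed.

Let de p : U p -> differentiable (fun q => expR (phi q)) p.
Proof. by move=> Up; apply: differentiable_expR; exact: dphi. Qed.

Let F0 p : U p -> F p != 0.
Proof. exact: (metric_neq0 oU U0 sF eF gU). Qed.

Let e0 p : expR (phi p) != 0.
Proof. by rewrite gt_eqF// expR_gt0. Qed.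

Lemma radial_factor p : U p -> radial phi p = 0.
Proof. by move=> Up; rewrite (ephi Up) mul0r. Qed.

Lemma radial_exp_factor p : U p -> radial (fun q => expR (phi q)) p = 0.
Proof.
move=> Up; rewrite -(mulr0 (expR (phi p))) -(radial_factor Up) /radial mulr_sumr.
by apply: eq_bigr => i _; rewrite (dy_expR i (dphi Up)) mulrCA.
Qed.

Lemma smooth_change : smooth_on U Fb.
Proof. exact: (smooth_onM oU (smooth_on_expR oU sphi) sF). Qed.

Lemma euler_change : euler U 1 Fb.
Proof.
move=> p Up; rewrite (radialM (de Up) (dF Up)) (radial_exp_factor Up) mul0r add0r.
by rewrite (radial_metric eF Up) mul1r.
Qed.

Lemma dy_factor i p : U p -> F p * dy i phi p = f p * m p 0 i.
Proof.
by move=> Up; exact: (vder2P oU U0 sF eF gU eps2 gE i Up (radial_factor Up)).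
Qed.

Lemma radial_frame i p : U p -> radial (fun q => m q 0 i) p = 0.
Proof.
move=> Up; apply: (mulfI (F0 Up)).
have r := frame_radial oU sF eF gU eps2 gE Up.
have E k := dy_frame oU U0 sF eF gU eps2 dm gE hI i k Up.
transitivity (- (dy i F p - eps * Is p * m p 0 i) * \sum_k p.2 0 k * m p 0 k).
  rewrite /radial !mulr_sumr; apply: eq_bigr => k _.
  by rewrite mulrCA E mulrCA.
by rewrite r !mulr0.
Qed.

(* The Euclidean square of m, nonzero because m is. *)
Let mm p : R := m p 0 0 * m p 0 0 + m p 0 1 * m p 0 1.

Let mm0 p : U p -> mm p != 0.
Proof.
by move=> Up; apply: sumsq_neq0; exact: (frame_neq0 gU gE Up).
Qed.

Let dmm p : U p -> differentiable mm p.
Proof.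
by move=> Up; apply: differentiableD; apply: differentiableM; exact: dm.
Qed.

Let ddphi i p : U p -> differentiable (dy i phi) p.
Proof. by move=> Up; exact: (smooth_on_diff (smooth_dy i sphi) Up). Qed.

(** f = phi_;2 is the quotient of F dy_i phi m_i by m_i m_i (Euclidean sums),
    which is an explicit differentiable function. *)
Lemma differentiable_vder p : U p -> differentiable f p.
Proof.
move=> Up.
have E : {in U, (fun q => F q * (dy 0 phi q * m q 0 0 + dy 1 phi q * m q 0 1) * (mm q)^-1) =1 f}.
  move=> q /[1!inE] Uq; apply: (mulIf (mm0 Uq)); rewrite mulfVK ?mm0//.
  rewrite mulrDr !mulrA (dy_factor 0 Uq) (dy_factor 1 Uq) /mm mulrDr !mulrA; reflexivity.
apply: (open_eq_differentiable oU E Up).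
apply: differentiableM; last by apply: differentiableV; [exact: dmm|exact: mm0].
apply: differentiableM; first exact: dF.
by apply: differentiableD; apply: differentiableM; (exact: dm || exact: ddphi).
Qed.

Lemma radial_vder p : U p -> radial f p = 0.
Proof.
move=> Up; have [i mi] := frame_neq0 gU gE Up.
apply: (mulIf mi); rewrite mul0r.
have E : {in U, (fun q => F q * dy i phi q) =1 (fun q => f q * m q 0 i)}.
  by move=> q /[1!inE] Uq; exact: dy_factor.
have := eq_radial oU E Up.
rewrite (radialM (dF Up) (ddphi i Up)) (radialM (differentiable_vder Up) (dm i Up)).
rewrite (radial_frame i Up) (radial_metric eF Up) (euler_dy oU i sphi ephi Up).
by rewrite mulr0 addr0 sub0r mulN1r mulrN subrr => <-.
Qed.

Lemma dy_vder k p : U p -> F p * dy k f p = vder2 F m f p * m p 0 k.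
Proof.
by move=> Up; exact: (vder2P oU U0 sF eF gU eps2 gE k Up (radial_vder Up)).
Qed.

Lemma differentiable_conf_ell i p : U p -> differentiable (L i) p.
Proof.
move=> Up; apply: differentiableD; first exact: ddF.
by apply: differentiableM; [exact: differentiable_vder|exact: dm].
Qed.

(** The weight W = 1 / rho enters here: F dy_k L_i = m_k (W m_i - f L_i). *)
Lemma dy_conf_ell i k p : U p ->
  F p * dy k (L i) p = m p 0 k * (W p * m p 0 i - f p * L i p).
Proof.
move=> Up; have df := differentiable_vder Up.
have dfm : differentiable (fun q => f q * m q 0 i) p.
  by apply: differentiableM; [exact: df|exact: dm].
rewrite /L (dyD k (ddF i Up) dfm) (dyM k df (dm i Up)).
have E1 := dydy_metric oU sF gE k i Up.
have E2 := dy_vder k Up.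
have E3 := dy_frame oU U0 sF eF gU eps2 dm gE hI i k Up.
have dist (x a b c g y : R) : x * (a + (b * y + g * c)) = x * a + x * b * y + g * (x * c).
  by ring.
rewrite dist E1 E2 E3 /W /sigma -/f.
move: (f p) (vder2 F m f p); atoms; move=> g g'; ring.
Qed.

Lemma dy_change j p : U p -> dy j Fb p = expR (phi p) * L j p.
Proof.
move=> Up; rewrite (dyM j (de Up) (dF Up)) (dy_expR j (dphi Up)).
by rewrite -mulrA [dy j phi p * _]mulrC (dy_factor j Up) -mulrDr addrC.
Qed.

Lemma dydy_change i j p : U p ->
  F p * dy i (dy j Fb) p = expR (phi p) * W p * (m p 0 i * m p 0 j).
Proof.
move=> Up.
have E : {in U, dy j Fb =1 (fun q => expR (phi q) * L j q)}.
  by move=> q /[1!inE]; exact: dy_change.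
rewrite (eq_dy oU i E Up) (dyM i (de Up) (differentiable_conf_ell j Up)).
rewrite (dy_expR i (dphi Up)) mulrDr.
rewrite [F p * (_ * dy i (L j) p)]mulrCA (dy_conf_ell j i Up).
rewrite -[_ * dy i phi p * L j p]mulrA [F p * _]mulrCA [F p * _]mulrA (dy_factor i Up).
by move: (f p) (W p) (L j p) (expR (phi p)); atoms; move=> a b c d; ring.
Qed.

Lemma gmx_change i j p : U p -> gmx Fb p i j =
  dy i Fb p * dy j Fb p + expR (phi p) ^+ 2 * W p * (m p 0 i * m p 0 j).
Proof.
move=> Up; rewrite (gmxE oU smooth_change i j Up); congr (_ + _).
rewrite {1}/Fb /change -[LHS]mulrA (dydy_change i j Up) !mulrA; reflexivity.
Qed.

(** W is recovered from the second fibre derivatives of Fbar by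
    [dydy_change]; this needs no differentiability of the main scalar nor of
    f_;2. *)
Lemma differentiable_conf_weight p : U p -> differentiable W p.
Proof.
move=> Up; pose H i j (q : tcoord R) : R := dy i (dy j Fb) q * (m q 0 i * m q 0 j).
have E : {in U, (fun q => F q * (H 0 0 q + H 0 1 q + (H 1 0 q + H 1 1 q)) *
    (expR (phi q) * (mm q * mm q))^-1) =1 W}.
  move=> q /[1!inE] Uq; have mq := mm0 Uq.
  have HE i j : F q * H i j q =
      expR (phi q) * W q * (m q 0 i * m q 0 j) * (m q 0 i * m q 0 j).
    by rewrite /H mulrA (dydy_change i j Uq).
  have D0 : expR (phi q) * (mm q * mm q) != 0 by rewrite !mulf_neq0.
  apply: (mulIf D0); rewrite (mulfVK D0) !mulrDr !HE /mm.
  by move: (W q) (expR (phi q)); atoms; move=> a b; ring.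
apply: (open_eq_differentiable oU E Up).
have dH i j : differentiable (H i j) p.
  apply: differentiableM.
    exact: (smooth_on_diff (smooth_dy i (smooth_dy j smooth_change)) Up).
  by apply: differentiableM; exact: dm.
have m0 := mm0 Up.
apply: differentiableM.
  apply: differentiableM; first exact: dF.
  by apply: differentiableD; apply: differentiableD; exact: dH.
apply: differentiableV; last by rewrite !mulf_neq0.
apply: differentiableM; first exact: de.
by apply: differentiableM; exact: dmm.
Qed.

Lemma radial_conf_weight p : U p -> radial W p = 0.
Proof.
move=> Up; have [i mi] := frame_neq0 gU gE Up.
have c0 : expR (phi p) * (m p 0 i * m p 0 i) != 0 by rewrite !mulf_neq0.
apply: (mulIf c0); rewrite mul0r.
have E : {in U, (fun q => F q * dy i (dy i Fb) q) =1
    (fun q => expR (phi q) * W q * (m q 0 i * m q 0 i))}.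
  by move=> q /[1!inE] Uq; exact: dydy_change.
have := eq_radial oU E Up.
have dW := differentiable_conf_weight Up.
have sdFb := smooth_dy i smooth_change.
have edFb := euler_dy oU i smooth_change euler_change.
have ddFb := smooth_on_diff (smooth_dy i sdFb) Up.
have deW : differentiable (fun q => expR (phi q) * W q) p.
  by apply: differentiableM; [exact: de|exact: dW].
have dmi : differentiable (fun q => m q 0 i * m q 0 i) p.
  by apply: differentiableM; exact: dm.
rewrite (radialM (dF Up) ddFb) (radialM deW dmi) (radialM (de Up) dW).
rewrite (radialM (dm i Up) (dm i Up)) (radial_frame i Up) (radial_exp_factor Up).
rewrite (radial_metric eF Up) (euler_dy oU i sdFb edFb Up).
generalize (dy i (dy i Fb) p) (m p 0 i).
move: (radial W p) (W p) (expR (phi p)) => a b c d n E'.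
have -> : a * (c * (n * n)) = (0 * b + c * a) * (n * n) + c * b * (0 * n + n * 0).
  by ring.
rewrite -E'; ring.
Qed.

Lemma dy_conf_weight k p : U p -> F p * dy k W p = vder2 F m W p * m p 0 k.
Proof.
by move=> Up; exact: (vder2P oU U0 sF eF gU eps2 gE k Up (radial_conf_weight Up)).
Qed.

(** In dy_k gbar_ij the terms in l cancel, and only a multiple of m_i m_j m_k
    remains. *)
Lemma cartan_change i j k p : U p -> cartan Fb i j k p =
  expR (phi p) ^+ 2 / (2 * F p) *
  (vder2 F m W p + 4 * f p * W p + 2 * eps * Is p * W p) *
  (m p 0 i * m p 0 j * m p 0 k).
Proof.
move=> Up; have dW := differentiable_conf_weight Up.
have dLL : differentiable (fun q => L i q * L j q) p.
  by apply: differentiableM; exact: differentiable_conf_ell.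
have dmij : differentiable (fun q => m q 0 i * m q 0 j) p.
  by apply: differentiableM; exact: dm.
have dWmm : differentiable (fun q => W q * (m q 0 i * m q 0 j)) p.
  by apply: differentiableM; [exact: dW|exact: dmij].
have dee : differentiable (fun q => expR (phi q) * expR (phi q)) p.
  by apply: differentiableM; exact: de.
have dS : differentiable (fun q => L i q * L j q + W q * (m q 0 i * m q 0 j)) p.
  by apply: differentiableD; [exact: dLL|exact: dWmm].
have E : {in U, (fun q => gmx Fb q i j) =1 (fun q => expR (phi q) * expR (phi q) *
    (L i q * L j q + W q * (m q 0 i * m q 0 j)))}.
  move=> q /[1!inE] Uq; rewrite (gmx_change i j Uq) (dy_change i Uq) (dy_change j Uq).
  by move: (expR (phi q)) (L i q) (L j q) (W q); atoms; move=> a b c d; ring.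
rewrite /cartan (eq_dy oU k E Up) (dyM k dee dS) (dyD k dLL dWmm).
rewrite (dyM k (de Up) (de Up)) (dyM k dW dmij).
rewrite (dyM k (differentiable_conf_ell i Up) (differentiable_conf_ell j Up)).
rewrite (dyM k (dm i Up) (dm j Up)) (dy_expR k (dphi Up)).
have E1 := dy_factor k Up; have E2 := dy_conf_weight k Up.
have E3 := dy_conf_ell i k Up; have E4 := dy_conf_ell j k Up.
have E5 := dy_frame oU U0 sF eF gU eps2 dm gE hI i k Up.
have E6 := dy_frame oU U0 sF eF gU eps2 dm gE hI j k Up.
set dmi := dy k (fun q => m q 0 i) p in E5 *.
set dmj := dy k (fun q => m q 0 j) p in E6 *.
have LiE : L i p = dy i F p + f p * m p 0 i by [].
have LjE : L j p = dy j F p + f p * m p 0 j by [].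
have F0p := F0 Up.
move: E1 E2 E3 E4 E5 E6 LiE LjE F0p.
move: dmi dmj => dmi dmj.
generalize (dy k phi p) (dy k W p) (dy k (L i) p) (dy k (L j) p).
move: (f p) (W p) (L i p) (L j p) (vder2 F m W p) (expR (phi p)) (F p) (Is p).
generalize (dy i F p) (dy j F p) (m p 0 i) (m p 0 j) (m p 0 k).
move=> li lj mi mj mk g w Li Lj w' e F1 I1 dphik dwk dLi dLj.
move=> E1 E2 E3 E4 E5 E6 LiE LjE F10.
have -> : dphik = g * mk / F1 by rewrite -E1 mulrAC mulfV// mul1r.
have -> : dwk = w' * mk / F1 by rewrite -E2 mulrAC mulfV// mul1r.
have -> : dLi = mk * (w * mi - g * Li) / F1 by rewrite -E3 mulrAC mulfV// mul1r.
have -> : dLj = mk * (w * mj - g * Lj) / F1 by rewrite -E4 mulrAC mulfV// mul1r.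
have -> : dmi = - (li - eps * I1 * mi) * mk / F1 by rewrite -E5 mulrAC mulfV// mul1r.
have -> : dmj = - (lj - eps * I1 * mj) * mk / F1 by rewrite -E6 mulrAC mulfV// mul1r.
by rewrite LiE LjE; field.
Qed.

Lemma change_det p : U p -> dy 0 Fb p * m p 0 1 - dy 1 Fb p * m p 0 0 != 0.
Proof.
move=> Up; rewrite (dy_change 0 Up) (dy_change 1 Up) /L.
have := frame_det gU gE Up; have := e0 p.
generalize (dy 0 F p) (dy 1 F p) (m p 0 0) (m p 0 1).
move: (expR (phi p)) (f p) => e g l0 l1 m0 m1 e1 D.
rewrite (_ : _ - _ = e * (l0 * m1 - l1 * m0)); last by ring.
by rewrite mulf_neq0.
Qed.

Lemma gmx_change_unit p : U p -> gmx Fb p \in unitmx.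
Proof.
move=> Up; apply: (@frame_unitmx _ _ (fun i => dy i Fb p) (m p 0)
  (expR (phi p) ^+ 2 * W p)); last exact: change_det.
  by move=> i j; exact: gmx_change.
by rewrite mulf_neq0 ?expf_neq0// hW.
Qed.

(** Since rho = 1 / W, one has (ln rho)_;2 = - W_;2 / W. *)
Lemma conf_invariant_eq0 p : U p ->
  expR (phi p) ^+ 2 / (2 * F p) *
  (vder2 F m W p + 4 * f p * W p + 2 * eps * Is p * W p) = 0 <->
  Is p = eps / 2 * (vder2 F m (rho eps F m Is phi) p / rho eps F m Is phi p - 4 * f p).
Proof.
move=> Up; have W0 := hW Up.
have rE : vder2 F m (rho eps F m Is phi) p = - (W p)^-1 ^+ 2 * vder2 F m W p.
  apply: (vder2_unique gU gE Up) => i.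
  have -> : dy i (rho eps F m Is phi) p = - (W p)^-1 ^+ 2 * dy i W p.
    exact: (derive_inv _ W0 (differentiable_conf_weight Up)).
  by rewrite mulrCA (dy_conf_weight i Up) mulrA.
have -> : rho eps F m Is phi p = (W p)^-1 by [].
rewrite rE; have F0p := F0 Up; have e1 := e0 p.
have eps0 := eps_neq0 eps2.
have c0 : expR (phi p) ^+ 2 / (2 * F p) != 0.
  by rewrite mulf_neq0 ?expf_neq0// invr_eq0 mulf_neq0// pnatr_eq0.
move: c0 W0; move: (expR _ ^+ 2 / _) (W p) (vder2 F m W p) (f p) (Is p) => c w w' g I1 c0 w0.
have RE : eps / 2 * (- w^-1 ^+ 2 * w' / w^-1 - 4 * g) =
  I1 - eps / (2 * w) * (w' + 4 * g * w + 2 * eps * I1 * w) + (eps * eps - 1) * I1.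
  by field.
rewrite RE eps2 subrr mul0r addr0; split => [/eqP|E].
  by rewrite mulf_eq0 (negPf c0) /= => /eqP->; rewrite mulr0 subr0.
have : eps / (2 * w) * (w' + 4 * g * w + 2 * eps * I1 * w) = 0.
  by rewrite -(subKr I1 (eps / _ * _)) -E subrr.
move/eqP; rewrite mulf_eq0 mulf_eq0 (negPf eps0) invr_eq0 mulf_eq0 (negPf w0) pnatr_eq0 /=.
by move=> /eqP->; rewrite mulr0.
Qed.

Lemma hdelta_change_frame i p : U p -> hdelta F i phi p =
  (hder1 F m phi p / expR (phi p)) * dy i Fb p +
  (hder2 F m phi p - hder1 F m phi p * f p) * m p 0 i.
Proof.
move=> Up; rewrite (hdelta_frame gU gE phi i Up) (dy_change i Up) /L.
have := e0 p; move: (expR (phi p)) (f p); atoms => e g e1.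
by field.
Qed.

Lemma horizontal_C_change p : U p ->
  (horizontal_C_at F Fb phi p <->
   Is p = eps / 2 * (vder2 F m (rho eps F m Is phi) p / rho eps F m Is phi p - 4 * f p)
   \/ hder2 F m phi p = hder1 F m phi p * f p) /\
  (riemannian_at Fb p <->
   Is p = eps / 2 * (vder2 F m (rho eps F m Is phi) p / rho eps F m Is phi p - 4 * f p)).
Proof.
move=> Up; rewrite -(conf_invariant_eq0 Up).
have [-> ->] := horizontal_C_frame (gmx_change_unit Up)
  (fun i j => gmx_change i j Up) (fun i j k => cartan_change i j k Up)
  (fun i => hdelta_change_frame i Up).
split=> //; split=> -[E|E]; [by left| |by left|]; right.
  by apply/eqP; rewrite -subr_eq0 E.
by rewrite E subrr.
Qed.

End Change.

(** * The geodesic spray *)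

Lemma open_nonzero (R : realType) (V : normedModType R) (U : set V) (g : V -> R) :
  open U -> (forall p, U p -> differentiable g p) ->
  open [set p | U p /\ g p != 0].
Proof.
move=> oU dg; rewrite openE => p [Up gp].
have nU : nbhs p U by exact: open_nbhs_nbhs.
have ng : nbhs p (g @^-1` [set x | x != 0]).
  apply: (differentiable_continuous (dg _ Up)).
  by apply: open_nbhs_nbhs; split; [exact: open_neq|].
by apply: filterS2 nU ng => q; split.
Qed.

(** If P fails at some point of every non-empty open part of U, and g vanishes
    wherever P fails, then g vanishes on U by continuity. *)
Lemma vanish_dense (R : realType) (V : normedModType R) (U : set V)
    (P : V -> Prop) (g : V -> R) : open U ->
  (forall p, U p -> differentiable g p) ->
  (forall W : set V, open W -> W `<=` U -> W !=set0 -> exists2 p, W p & ~ P p) ->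
  (forall p, U p -> P p \/ g p = 0) -> forall p, U p -> g p = 0.
Proof.
move=> oU dg dense Pg p Up; apply: contrapT => /eqP gp.
have [| | q [Uq gq] nPq] := dense _ (open_nonzero oU dg).
- by move=> q [].
- by exists p.
by have [//|g0] := Pg q Uq; rewrite g0 eqxx in gq.
Qed.

Lemma invmx2_applyV (K : fieldType) (G : 'M[K]_2) (u v : 'I_2 -> K) j :
  G \in unitmx -> (forall i, v i = \sum_k invmx G i k * u k) ->
  \sum_i G j i * v i = u j.
Proof.
move=> uG vE.
have E : (\col_i v i) = invmx G *m (\col_k u k).
  by apply/colP => i; rewrite !mxE vE; apply: eq_bigr => k _; rewrite mxE.
have := congr1 (fun A : 'cV_2 => A j 0) (mulKVmx uG (\col_k u k)).
by rewrite -E !mxE => <-; apply: eq_bigr => i _; rewrite mxE.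
Qed.

(** The algebra of [spray_energy]: a is the fibre Hessian of F^2 and e its fibre
    gradient, x its x-derivatives and c its mixed second derivatives. *)
Lemma spray_energy_alg (K : comPzRingType)
    (y0 y1 a00 a01 a10 a11 e0 e1 G0 G1 x0 x1 c00 c01 c10 c11 : K) :
  a10 = a01 -> y0 * a00 + y1 * a10 = e0 -> y0 * a01 + y1 * a11 = e1 ->
  a00 * (2 * G0) + a01 * (2 * G1) = y0 * c00 + y1 * c10 - x0 ->
  a10 * (2 * G0) + a11 * (2 * G1) = y0 * c01 + y1 * c11 - x1 ->
  y0 * c00 + y1 * c01 = 2 * x0 -> y0 * c10 + y1 * c11 = 2 * x1 ->
  y0 * x0 + y1 * x1 = 2 * (G0 * e0 + G1 * e1).
Proof.
move=> a10E <- <- s0 s1 r0 r1.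
transitivity (y0 * (y0 * c00 + y1 * c10 - x0) + y1 * (y0 * c01 + y1 * c11 - x1)).
  transitivity (y0 * (y0 * c00 + y1 * c01) + y1 * (y0 * c10 + y1 * c11)
    - y0 * x0 - y1 * x1); last by ring.
  by rewrite r0 r1; ring.
by rewrite -s0 -s1 a10E; ring.
Qed.

(** The algebra of [metric_horizontal]. *)
Lemma metric_horizontal_alg (K : numFieldType) (x a b c : K) :
  2 * c = b - x -> x + b = 2 * (a + c) -> x = a.
Proof.
move=> cE aE; apply: (@mulfI _ 2); first by rewrite pnatr_eq0.
have -> : 2 * x = (x + b) - (b - x) by ring.
by rewrite aE -cE; ring.
Qed.

(** The algebra of [spray_unique] for a fixed index k: e is the fibre gradient of
    F^2, a the k-th row of its Hessian, g_rj stands for dy_r G^j, k_j for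
    dy_k G^j, and h, l are the fibre gradients of k_0 and k_1. *)
Lemma spray_unique_alg (K : comPzRingType) (y0 y1 G0 G1 e0 e1 a0 a1 : K)
    (g00 g01 g10 g11 h0 h1 k0 k1 l0 l1 : K) :
  y0 * h0 + y1 * h1 = k0 -> y0 * l0 + y1 * l1 = k1 ->
  y0 * g00 + y1 * g10 = 2 * G0 -> y0 * g01 + y1 * g11 = 2 * G1 ->
  a0 * (2 * G0) + a1 * (2 * G1) =
  y0 * (h0 * e0 + g00 * a0 + (l0 * e1 + g01 * a1)) +
  y1 * (h1 * e0 + g10 * a0 + (l1 * e1 + g11 * a1)) - (k0 * e0 + k1 * e1).
Proof.
move=> <- <- r0 r1.
transitivity ((2 * G0) * a0 + (2 * G1) * a1); first by ring.
by rewrite -r0 -r1; ring.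
Qed.

Section Spray.
Variables (R : realType) (U : set (tcoord R)) (F : tcoord R -> R).
Hypothesis oU : open U.
Hypothesis sF : smooth_on U F.
Hypothesis eF : euler U 1 F.
Hypothesis gU : forall p, U p -> gmx F p \in unitmx.
Implicit Types (p : tcoord R) (i j k : 'I_2).

Let E : tcoord R -> R := fun q => F q ^+ 2.
(* E is the energy, and the spray coefficients solve 4 g_kj G^j = T_k. *)
Let T k p : R := \sum_r p.2 0 r * dx r (dy k E) p - dx k E p.

Lemma smooth_energy : smooth_on U E.
Proof. exact: smooth_onX2. Qed.

Lemma euler_energy : euler U 2 E.
Proof.
move=> p Up; have dF := smooth_on_diff sF Up.
transitivity (radial (fun q => F q * F q) p); first by [].
by rewrite (radialM dF dF) (radial_metric eF Up) /E; ring.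
Qed.

Let sdE j : smooth_on U (dy j E).
Proof. exact: smooth_dy smooth_energy. Qed.

Let ddE j p : U p -> differentiable (dy j E) p.
Proof. exact: smooth_on_diff (sdE j). Qed.

Let sxE j : smooth_on U (dx j E).
Proof. exact: smooth_dx smooth_energy. Qed.

Lemma gmx_energy i j p : gmx F p i j = 2^-1 * dy i (dy j E) p.
Proof. exact: mxE. Qed.

Lemma smooth_gmx i j : smooth_on U (fun q => gmx F q i j).
Proof.
have s := smooth_onM oU (smooth_on_cst oU (2^-1 : R)) (smooth_dy i (sdE j)).
by apply: (eq_smooth_on oU _ s) => q _; rewrite gmx_energy.
Qed.

Lemma smooth_ginv i j : smooth_on U (fun q => ginv F q i j).
Proof.
pose d q := gmx F q 0 0 * gmx F q 1 1 - gmx F q 0 1 * gmx F q 1 0.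
have sd : smooth_on U d.
  exact: (smooth_onB oU (smooth_onM oU (smooth_gmx 0 0) (smooth_gmx 1 1))
    (smooth_onM oU (smooth_gmx 0 1) (smooth_gmx 1 0))).
have d0 p : U p -> d p != 0.
  by move=> /gU; rewrite unitmxE unitfE det2E.
have sdV := smooth_onV oU d0 sd.
have sM a b := smooth_onM oU sdV (smooth_gmx a b).
have sN a b := smooth_onB oU (smooth_on_cst oU 0) (sM a b).
move: i j; apply: ord2P; apply: ord2P.
- apply: (eq_smooth_on oU _ (sM 1 1)) => q /[1!inE] /gU/invmx2E[e _ _ _].
  by rewrite [RHS]e det2E.
- apply: (eq_smooth_on oU _ (sN 0 1)) => q /[1!inE] /gU/invmx2E[_ e _ _].
  by rewrite [RHS]e det2E sub0r.
- apply: (eq_smooth_on oU _ (sN 1 0)) => q /[1!inE] /gU/invmx2E[_ _ e _].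
  by rewrite [RHS]e det2E sub0r.
apply: (eq_smooth_on oU _ (sM 0 0)) => q /[1!inE] /gU/invmx2E[_ _ _ e].
by rewrite [RHS]e det2E.
Qed.

Lemma smooth_spray_rhs k : smooth_on U (T k).
Proof.
exact: (smooth_onB oU (smooth_on_sum2 oU (fun r =>
  smooth_onM oU (smooth_y oU r) (smooth_dx r (sdE k)))) (sxE k)).
Qed.

Lemma smooth_spray i : smooth_on U (spray F i).
Proof.
exact: (smooth_onM oU (smooth_on_cst oU 4^-1) (smooth_on_sum2 oU (fun k =>
  smooth_onM oU (smooth_ginv i k) (smooth_spray_rhs k)))).
Qed.

Lemma gmx_spray k p : U p -> \sum_j gmx F p k j * (4 * spray F j p) = T k p.
Proof.
move=> Up; apply: (invmx2_applyV (u := T ^~ p)); first exact: gU.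
by move=> i; rewrite /spray mulVKf ?pnatr_eq0.
Qed.

Lemma spray_unique_at p (G : 'I_2 -> R) j : U p ->
  (forall k, \sum_j gmx F p k j * (4 * G j) = T k p) -> spray F j p = G j.
Proof.
move=> Up GT; rewrite /spray.
rewrite -/(ginv F p) (_ : \sum_k _ = 4 * G j); first by rewrite mulKf ?pnatr_eq0.
exact: (invmx2_apply j (gU Up) GT).
Qed.

Let gmx_half k j p (x : R) : gmx F p k j * (4 * x) = dy k (dy j E) p * (2 * x).
Proof. by rewrite gmx_energy; generalize (dy k (dy j E) p) => a; field. Qed.

Lemma hessian_spray k p : U p ->
  \sum_j dy k (dy j E) p * (2 * spray F j p) = T k p.
Proof.
by move=> Up; rewrite -(gmx_spray k Up); apply: eq_bigr => j _; rewrite gmx_half.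
Qed.

Lemma hessian_spray_unique p (G : 'I_2 -> R) j : U p ->
  (forall k, \sum_j dy k (dy j E) p * (2 * G j) = T k p) -> spray F j p = G j.
Proof.
move=> Up GT; apply: (spray_unique_at j Up) => k; rewrite -GT.
by apply: eq_bigr => i _; rewrite gmx_half.
Qed.

Lemma euler_spray i : euler U 2 (spray F i).
Proof.
move=> p Up.
have ds j := smooth_on_diff (smooth_spray j) Up.
have dg j k := smooth_on_diff (smooth_gmx j k) Up.
have rg k j : radial (fun q => gmx F q k j) p = 0.
  have Eg : {in U, (fun q => gmx F q k j) =1 (fun q => 2^-1 * dy k (dy j E) q)}.
    by move=> q _; rewrite gmx_energy.
  have ddd := smooth_on_diff (smooth_dy k (sdE j)) Up.
  rewrite (eq_radial oU Eg Up) (radialZ 2^-1 ddd).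
  rewrite (euler_dy oU k (sdE j) (euler_dy oU j smooth_energy euler_energy) Up).
  by rewrite -[2 in X in X * _]/(1 + 1) addrK subrr mul0r mulr0.
have rT k : radial (T k) p = 2 * T k p.
  have dxdy r := smooth_on_diff (smooth_dx r (sdE k)) Up.
  have dyr r := differentiableM (differentiable_y r p) (dxdy r).
  have ry r : radial (fun q : tcoord R => q.2 0 r * dx r (dy k E) q) p =
      2 * (p.2 0 r * dx r (dy k E) p).
    rewrite (radialM (differentiable_y r p) (dxdy r)) radial_y.
    rewrite (euler_dx oU r (sdE k) (euler_dy oU k smooth_energy euler_energy) Up).
    by generalize (dx r (dy k E) p) (p.2 0 r) => a b; ring.
  have dxE := smooth_on_diff (sxE k) Up.
  have dS := smooth_on_diff (smooth_on_sum2 oU (fun r =>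
    smooth_onM oU (smooth_y oU r) (smooth_dx r (sdE k)))) Up.
  rewrite (radialB dS dxE) (radial_sum dyr) (eq_bigr _ (fun r _ => ry r)).
  by rewrite (euler_dx oU k smooth_energy euler_energy Up) -mulr_sumr -mulrBr.
have key k : \sum_j gmx F p k j * (4 * (2^-1 * radial (spray F j) p)) = T k p.
  have E1 : {in U, (fun q => \sum_j gmx F q k j * (4 * spray F j q)) =1 T k}.
    by move=> q /[1!inE] Uq; rewrite -(gmx_spray k Uq).
  have d4 j : differentiable (fun q => 4 * spray F j q) p.
    exact: (smooth_on_diff (smooth_onM oU (smooth_on_cst oU 4) (smooth_spray j)) Up).
  have rS j : radial (fun q => gmx F q k j * (4 * spray F j q)) p =
      gmx F p k j * (4 * radial (spray F j) p).
    by rewrite (radialM (dg k j) (d4 j)) rg mul0r add0r (radialZ 4 (ds j)).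
  apply: (@mulfI _ 2); first by rewrite pnatr_eq0.
  rewrite -(rT k) -(eq_radial oU E1 Up).
  rewrite (radial_sum (fun j => differentiableM (dg k j) (d4 j))).
  rewrite (eq_bigr _ (fun j _ => rS j)) mulr_sumr; apply: eq_bigr => j _.
  by rewrite mulrCA [2 * _]mulrCA mulVKf ?pnatr_eq0.
have := spray_unique_at i Up key => ->.
by rewrite mulVKf ?pnatr_eq0.
Qed.

(** Contracting the definition of G with y: y^r dx_r E = 2 G^j dy_j E. *)
Lemma spray_energy p : U p ->
  \sum_r p.2 0 r * dx r E p = 2 * \sum_j spray F j p * dy j E p.
Proof.
move=> Up.
have e1 k : radial (dy k E) p = dy k E p.
  by rewrite (euler_dy oU k smooth_energy euler_energy Up) -[2]/(1 + 1) addrK mul1r.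
have e2 r : radial (dx r E) p = 2 * dx r E p.
  exact: (euler_dx oU r smooth_energy euler_energy Up).
have s k := hessian_spray k Up.
have c r k := dx_dy oU r k smooth_energy Up.
have s0 := s 0; have s1 := s 1; have e10 := e1 0; have e11 := e1 1.
have e20 := e2 0; have e21 := e2 1.
rewrite /radial sum2E in e10. 
rewrite /radial sum2E in e11.
rewrite /radial sum2E in e20.
rewrite /radial sum2E in e21.
rewrite sum2E in s0.
rewrite sum2E in s1.
rewrite /T in s0.
rewrite sum2E in s0.
rewrite /T in s1.
rewrite sum2E in s1.
rewrite (c 0 0) (c 1 0) in s0; rewrite (c 0 1) (c 1 1) in s1.
have a10 := dy_dy oU 1 0 smooth_energy Up.
apply: (etrans (sum2E _)).
apply: (etrans (spray_energy_alg a10 e10 e11 s0 s1 e20 e21)).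
exact: (congr1 (fun a => 2 * a) (esym (sum2E _))).
Qed.

(** The geodesic spray annihilates the energy E = F^2 horizontally, that is
    delta_i E = 0: differentiate [spray_energy] along the fibre and subtract
    the definition of G. *)
Lemma metric_horizontal i p : U p ->
  dx i E p = \sum_j dy i (spray F j) p * dy j E p.
Proof.
move=> Up.
have ds j := smooth_on_diff (smooth_spray j) Up.
have dde j := ddE j Up.
have dxe j := smooth_on_diff (sxE j) Up.
have E1 : {in U, (fun q : tcoord R => \sum_r q.2 0 r * dx r E q) =1
    (fun q => 2 * \sum_j spray F j q * dy j E q)}.
  by move=> q /[1!inE]; exact: spray_energy.
have dS j := differentiableM (ds j) (dde j).
have dSS := smooth_on_diff (smooth_on_sum2 oU (fun j =>
  smooth_onM oU (smooth_spray j) (sdE j))) Up.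
have := eq_dy oU i E1 Up.
rewrite (dy_fiber_sum i dxe) (dyZ i 2 dSS) (dy_sum i dS).
rewrite (eq_bigr _ (fun j _ => dyM i (ds j) (dde j))) big_split /=.
have ET : \sum_j dy i (dy j E) p * (2 * spray F j p) =
    2 * \sum_j spray F j p * dy i (dy j E) p.
  by rewrite mulr_sumr; apply: eq_bigr => j _; rewrite mulrC mulrA.
have Ec : \sum_r p.2 0 r * dx r (dy i E) p = \sum_r p.2 0 r * dy i (dx r E) p.
  apply: eq_bigr => r _.
  exact: (congr1 (fun a => p.2 0 r * a) (dx_dy oU r i smooth_energy Up)).
have Eb : 2 * (\sum_j spray F j p * dy i (dy j E) p) =
    \sum_r p.2 0 r * dy i (dx r E) p - dx i E p.
  apply: (etrans (esym ET)); apply: (etrans (hessian_spray i Up)).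
  rewrite /T.
  exact: (congr1 (fun a => a - dx i E p) Ec).
move=> Ea; exact: metric_horizontal_alg Eb Ea.
Qed.

(** Conversely, functions G^j of degree 2 with dx_i E = dy_i G^j dy_j E are the
    spray coefficients of F. *)
Lemma spray_unique (G : 'I_2 -> tcoord R -> R) :
  (forall j, smooth_on U (G j)) -> (forall j, euler U 2 (G j)) ->
  (forall i p, U p -> dx i E p = \sum_j dy i (G j) p * dy j E p) ->
  forall j p, U p -> spray F j p = G j p.
Proof.
move=> sG eG EG j p Up; apply: (@hessian_spray_unique p (fun j => G j p) j Up) => k.
have dG i l := smooth_on_diff (smooth_dy i (sG l)) Up.
have dde l := ddE l Up.
have xyE r : dx r (dy k E) p =
    dy r (dy k (G 0)) p * dy 0 E p + dy r (G 0) p * dy k (dy 0 E) p +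
    (dy r (dy k (G 1)) p * dy 1 E p + dy r (G 1) p * dy k (dy 1 E) p).
  have E1 : {in U, dx r E =1 (fun q => dy r (G 0) q * dy 0 E q + dy r (G 1) q * dy 1 E q)}.
    by move=> q /[1!inE] Uq; rewrite (EG r q Uq) sum2E.
  rewrite (dx_dy oU r k smooth_energy Up) (eq_dy oU k E1 Up).
  rewrite (dyD k (differentiableM (dG r 0) (dde 0)) (differentiableM (dG r 1) (dde 1))).
  rewrite (dyM k (dG r 0) (dde 0)) (dyM k (dG r 1) (dde 1)).
  by rewrite (dy_dy oU k r (sG 0) Up) (dy_dy oU k r (sG 1) Up).
have r1 l : radial (dy k (G l)) p = dy k (G l) p.
  by rewrite (euler_dy oU k (sG l) (eG l) Up) -[2]/(1 + 1) addrK mul1r.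
have r2 l : radial (G l) p = 2 * G l p by exact: eG.
have r10 := r1 0; have r11 := r1 1; have r20 := r2 0; have r21 := r2 1.
rewrite /radial sum2E in r10.
rewrite /radial sum2E in r11.
rewrite /radial sum2E in r20.
rewrite /radial sum2E in r21.
have XE := sum2E (fun r => p.2 0 r * dx r (dy k E) p).
rewrite (xyE 0) (xyE 1) in XE.
apply: (etrans (sum2E _)).
rewrite /T; apply: etrans _ (congr2 (fun a b => a - b) (esym XE)
  (esym (etrans (EG k p Up) (sum2E _)))).
exact: spray_unique_alg r10 r11 r20 r21.
Qed.

End Spray.

(** * Invariance of the spray *)

#[local] Opaque spray.
#[local] Transparent hdelta.

Section SprayInvariance.
Variables (R : realType) (U : set (tcoord R)) (F phi : tcoord R -> R).
Variables (eps : R) (m : tcoord R -> 'rV[R]_2) (Is : tcoord R -> R).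
Hypothesis oU : open U.
Hypothesis U0 : forall p, U p -> p.2 != 0.
Hypothesis sF : smooth_on U F.
Hypothesis eF : euler U 1 F.
Hypothesis gU : forall p, U p -> gmx F p \in unitmx.
Hypothesis eps2 : eps * eps = 1.
Hypothesis dm : forall p i, U p -> differentiable (fun q => m q 0 i) p.
Hypothesis gE : forall p, U p -> forall i j,
  gmx F p i j = ell F p 0 i * ell F p 0 j + eps * (m p 0 i * m p 0 j).
Hypothesis hI : forall p, U p -> forall i j k,
  F p * cartan F i j k p = Is p * m p 0 i * m p 0 j * m p 0 k.
Hypothesis sphi : smooth_on U phi.
Hypothesis ephi : euler U 0 phi.
Hypothesis hW : forall p, U p ->
  sigma eps F m Is phi p + eps - vder2 F m phi p ^+ 2 != 0.
Let f := vder2 F m phi.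
Let Fb := change F phi.

Let sFb : smooth_on U Fb := smooth_change oU sF sphi.
Let eFb : euler U 1 Fb := euler_change sF eF sphi ephi.
Let gUb p (Up : U p) : gmx Fb p \in unitmx :=
  gmx_change_unit oU U0 sF eF gU eps2 dm gE hI sphi ephi hW Up.

Lemma hdelta_sq (F' h : tcoord R -> R) i p : differentiable h p ->
  hdelta F' i (fun q => h q ^+ 2) p = 2 * h p * hdelta F' i h p.
Proof.
move=> dh; rewrite /hdelta !sum2E (dxX2 i dh) (dyX2 0 dh) (dyX2 1 dh).
by generalize (dx i h p); atoms; move=> a; ring.
Qed.

Lemma hdelta_metric (F' : tcoord R -> R) i p : smooth_on U F' -> euler U 1 F' ->
  (forall p, U p -> gmx F' p \in unitmx) -> U p ->
  hdelta F' i F' p = 0.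
Proof.
move=> sF' eF' gU' Up; have F0 := metric_neq0 oU U0 sF' eF' gU' Up.
have dF' := smooth_on_diff sF' Up.
apply: (@mulfI _ (2 * F' p)); first by rewrite mulf_neq0 ?pnatr_eq0.
rewrite mulr0 -(hdelta_sq F' i dF') /hdelta.
by rewrite (metric_horizontal oU sF' eF' gU' i Up) subrr.
Qed.

(** delta_i is a derivation and delta_i F = 0. *)
Lemma hdelta_change i p : U p -> hdelta F i Fb p = Fb p * hdelta F i phi p.
Proof.
move=> Up; have dF := smooth_on_diff sF Up.
have dphi := smooth_on_diff sphi Up; have de := differentiable_expR dphi.
have H0 := hdelta_metric i sF eF gU Up.
rewrite -[RHS]addr0 -[in RHS](mulr0 (expR (phi p))) -[in RHS]H0.
rewrite /hdelta !sum2E (dxM i de dF) (dyM 0 de dF) (dyM 1 de dF).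
rewrite (dx_expR i dphi) (dy_expR 0 dphi) (dy_expR 1 dphi).
have -> : Fb p = expR (phi p) * F p by [].
generalize (dx i phi p) (dx i F p) (expR (phi p)) (F p); atoms.
by move=> a b c d; ring.
Qed.

Lemma same_spray_iff :
  (forall i p, U p -> spray Fb i p = spray F i p) <->
  (forall i p, U p -> hdelta F i phi p = 0).
Proof.
split=> [same i p Up|d0 i p Up].
  have Fb0 := metric_neq0 oU U0 sFb eFb gUb Up.
  apply: (mulfI Fb0); rewrite mulr0 -(hdelta_change i Up).
  apply: etrans _ (hdelta_metric i sFb eFb gUb Up).
  have S : \sum_j dy i (spray F j) p * dy j Fb p = \sum_j dy i (spray Fb j) p * dy j Fb p.
    apply: eq_bigr => j _; apply: (congr1 (fun a => a * dy j Fb p)).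
    by apply: (eq_dy oU i _ Up) => q /[1!inE] Uq; rewrite (same j q Uq).
  exact: (congr1 (fun a => dx i Fb p - a) S).
apply: (spray_unique oU sFb gUb (smooth_spray oU sF gU)
  (euler_spray oU sF eF gU) _ i Up) => k q Uq.
have dFb := smooth_on_diff sFb Uq.
have := hdelta_sq F k dFb; rewrite (hdelta_change k Uq) (d0 k q Uq) !mulr0.
by rewrite /hdelta => /eqP; rewrite subr_eq0 => /eqP.
Qed.

Let smooth_hdelta i : smooth_on U (hdelta F i phi).
Proof.
exact: (smooth_onB oU (smooth_dx i sphi) (smooth_on_sum2 oU (fun j =>
  smooth_onM oU (smooth_dy i (smooth_spray oU sF gU j)) (smooth_dy j sphi)))).
Qed.

(** A proportionality of delta phi with the fibre differential of F' which holds
    off a set without interior holds everywhere. *)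
Lemma hdelta_parallel (F' : tcoord R -> R) (P : tcoord R -> Prop) : smooth_on U F' ->
  (forall W : set (tcoord R), open W -> W `<=` U -> W !=set0 ->
     exists2 p, W p & ~ P p) ->
  (forall p, U p -> P p \/ exists a, forall i, hdelta F i phi p = a * dy i F' p) ->
  forall p, U p -> hdelta F 0 phi p * dy 1 F' p = hdelta F 1 phi p * dy 0 F' p.
Proof.
move=> sF' dense par p Up; apply/eqP; rewrite -subr_eq0; apply/eqP.
pose g q := hdelta F 0 phi q * dy 1 F' q - hdelta F 1 phi q * dy 0 F' q.
have sg : smooth_on U g.
  exact: (smooth_onB oU (smooth_onM oU (smooth_hdelta 0) (smooth_dy 1 sF'))
    (smooth_onM oU (smooth_hdelta 1) (smooth_dy 0 sF'))).
have dg q (Uq : U q) := smooth_on_diff sg Uq.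
apply: (vanish_dense oU dg dense _ Up) => q Uq.
have [Pq|[a aE]] := par q Uq; [by left|right].
by rewrite /g (aE 0) (aE 1) mulrAC subrr.
Qed.

(** If phi depends on x only near p and d phi is proportional to l there, then
    d phi vanishes at p. With s = y^r dx_r phi the hypothesis reads
    F dx_i phi = s l_i, and its fibre derivative reduces to
    s dy_k l_i = 0; but dy_k l_k is nonzero for some k. *)
Lemma basic_factor_const (V : set (tcoord R)) p : open V -> V `<=` U -> V p ->
  (forall q, V q -> forall k, dy k phi q = 0) ->
  (forall q, V q -> exists a, forall i, dx i phi q = a * dy i F q) ->
  forall i, dx i phi p = 0.
Proof.
move=> oV VU Vp dy0 par; have Up := VU _ Vp.
pose s (q : tcoord R) : R := \sum_r q.2 0 r * dx r phi q.
have sphiV : smooth_on V phi by move=> l q Vq; apply: sphi; exact: VU.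
have dxs i := smooth_on_diff (smooth_dx i sphi) Up.
have dF := smooth_on_diff sF Up.
have ds := smooth_on_diff (smooth_on_sum2 oU (fun r =>
  smooth_onM oU (smooth_y oU r) (smooth_dx r sphi))) Up.
have sE q i : V q -> F q * dx i phi q = s q * dy i F q.
  move=> Vq; have [a aE] := par q Vq; have r1 := radial_metric eF (VU _ Vq).
  rewrite aE mulrCA mulrA; congr (_ * _).
  rewrite -r1 /s /radial mulr_sumr; apply: eq_bigr => r _.
  by rewrite aE; generalize (dy r F q) (q.2 0 r) => x y; ring.
have dyx k i : dy k (dx i phi) p = 0.
  rewrite -(dx_dy oU i k sphi Up).
  have E0 : {in V, dy k phi =1 (fun=> 0)} by move=> q /[1!inE] /dy0.
  rewrite (eq_dx oV i E0 Vp).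
  exact: (derive_cst (0 : R)).
have dys k : dy k s p = dx k phi p.
  rewrite /s (dy_fiber_sum k dxs) big1 ?addr0// => r _.
  by rewrite dyx mulr0.
have [k mk] := frame_neq0 gU gE Up.
have s0 : s p = 0.
  have E1 : {in V, (fun q => F q * dx k phi q) =1 (fun q => s q * dy k F q)}.
    by move=> q /[1!inE]; exact: sE.
  have ddF := smooth_on_diff (smooth_dy k sF) Up.
  have := eq_dy oV k E1 Vp.
  rewrite (dyM k dF (dxs k)) (dyM k ds ddF) dyx dys mulr0 addr0.
  rewrite [LHS]mulrC -[LHS]addr0 => /addrI/esym/eqP.
  rewrite mulf_eq0 => /orP[/eqP//|/eqP ddF0].
  have := dydy_metric oU sF gE k k Up; rewrite ddF0 mulr0 => /esym/eqP.
  by rewrite !mulf_eq0 (negPf mk) (negPf (eps_neq0 eps2)).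
move=> i; apply: (mulfI (metric_neq0 oU U0 sF eF gU Up)).
by rewrite (sE p i Vp) s0 mul0r mulr0.
Qed.

(** Where delta phi is nonzero, phi_;2 vanishes, so that
    [basic_factor_const] applies near every such point. *)
Lemma hdelta_eq0 :
  (forall p, U p -> hder2 F m phi p = 0) ->
  (forall p, U p -> hder1 F m phi p * f p = 0) ->
  forall i p, U p -> hdelta F i phi p = 0.
Proof.
move=> h2 h1f i p Up; apply: contrapT => /eqP di.
pose V := [set q | U q /\ hdelta F i phi q != 0].
have oV : open V.
  apply: open_nonzero => // q Uq; exact: (smooth_on_diff (smooth_hdelta i) Uq).
have VU : V `<=` U by move=> q [].
have dE q k : U q -> hdelta F k phi q = hder1 F m phi q * dy k F q.
  by move=> Uq; rewrite (hdelta_frame gU gE phi k Uq) (h2 q Uq) mul0r addr0.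
have dy0 q : V q -> forall k, dy k phi q = 0.
  move=> [Uq dq] k; apply: (mulfI (metric_neq0 oU U0 sF eF gU Uq)).
  rewrite mulr0 (dy_factor oU U0 sF eF gU eps2 gE ephi k Uq).
  have /eqP := h1f q Uq; rewrite mulf_eq0 => /orP[/eqP h1|/eqP fq].
    by rewrite (dE q i Uq) h1 mul0r eqxx in dq.
  by rewrite -/f fq mul0r.
have dxE q k : V q -> dx k phi q = hdelta F k phi q.
  by move=> Vq; rewrite /hdelta big1 ?subr0// => j _; rewrite dy0// mulr0.
have Vp : V p by [].
have dx0 := basic_factor_const oV VU Vp dy0.
move/eqP: di; apply; rewrite -(dxE p i Vp); apply: dx0 => q Vq.
by exists (hder1 F m phi q) => k; rewrite (dxE q k Vq); apply: dE; exact: VU.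
Qed.

(** The statement on the spray in one chart. *)
Lemma horizontal_both_iff :
  (forall W : set (tcoord R), open W -> W `<=` U -> W !=set0 ->
     exists2 p, W p & ~ riemannian_at F p) ->
  (forall W : set (tcoord R), open W -> W `<=` U -> W !=set0 ->
     exists2 p, W p & ~ riemannian_at Fb p) ->
  (forall p, U p -> horizontal_C_at F F phi p) /\
  (forall p, U p -> horizontal_C_at F Fb phi p) <->
  (forall i p, U p -> spray Fb i p = spray F i p).
Proof.
move=> nF nFb; rewrite same_spray_iff; split=> [[hC hCb]|d0]; last first.
  split=> p Up j k; rewrite big1// => i _; by rewrite (d0 i p Up) mul0r.
have par p : U p -> hdelta F 0 phi p * dy 1 F p = hdelta F 1 phi p * dy 0 F p.
  apply: (hdelta_parallel sF nF) => {}p Up.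
  have [//|h2] := (horizontal_C_metric oU U0 sF eF gU gE hI phi Up).1 (hC p Up); first by left.
  right; exists (hder1 F m phi p) => i.
  by rewrite (hdelta_frame gU gE phi i Up) h2 mul0r addr0.
have parb p : U p -> hdelta F 0 phi p * dy 1 Fb p = hdelta F 1 phi p * dy 0 Fb p.
  apply: (hdelta_parallel sFb nFb) => {}p Up.
  have [hb rb] := horizontal_C_change oU U0 sF eF gU eps2 dm gE hI sphi ephi hW Up.
  have [Ip|h2] := hb.1 (hCb p Up); first by left; apply/rb.
  right; exists (hder1 F m phi p / expR (phi p)) => i.
  rewrite (hdelta_change_frame oU U0 sF eF gU eps2 gE sphi ephi i Up) h2 subrr.
  by rewrite mul0r addr0.
have h2 p : U p -> hder2 F m phi p = 0.
  move=> Up; have := par p Up; have := frame_det gU gE Up.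
  rewrite (hdelta_frame gU gE phi 0 Up) (hdelta_frame gU gE phi 1 Up).
  generalize (hder1 F m phi p) (hder2 F m phi p) (dy 0 F p) (dy 1 F p)
    (m p 0 0) (m p 0 1) => a b l0 l1 m0 m1 D E.
  apply: (mulIf D); rewrite mul0r.
  have -> : b * (l0 * m1 - l1 * m0) =
    (a * l1 + b * m1) * l0 - (a * l0 + b * m0) * l1 by ring.
  by rewrite E subrr.
apply: hdelta_eq0 => // p Up.
have := parb p Up; have := frame_det gU gE Up.
rewrite (hdelta_frame gU gE phi 0 Up) (hdelta_frame gU gE phi 1 Up) (h2 p Up).
rewrite (dy_change oU U0 sF eF gU eps2 gE sphi ephi 0 Up).
rewrite (dy_change oU U0 sF eF gU eps2 gE sphi ephi 1 Up) -/f.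
have e0 : expR (phi p) != 0 by rewrite gt_eqF// expR_gt0.
move: e0; generalize (hder1 F m phi p) (f p) (dy 0 F p) (dy 1 F p)
    (m p 0 0) (m p 0 1) (expR (phi p)) => a g l0 l1 m0 m1 e e0 D E.
apply: (mulIf (mulf_neq0 e0 D)); rewrite mul0r.
have -> : a * g * (e * (l0 * m1 - l1 * m0)) =
  (a * l0 + 0 * m0) * (e * (l1 + g * m1)) - (a * l1 + 0 * m1) * (e * (l0 + g * m0)).
  by ring.
by rewrite E subrr.
Qed.

End SprayInvariance.

Theorem theorem3p9 (R : realType) (M : topologicalType) (I : Type)
    (c : I -> chart R M) (A : I -> set (tcoord R))
    (F phi : I -> tcoord R -> R) (eps : R)
    (m : I -> tcoord R -> 'rV[R]_2) (Is : I -> tcoord R -> R)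
    (hM : smooth_surface c) (hA : conic_subbundle c A)
    (hF : conic_pseudo_finsler c A F) (hm : berwald_frame A F eps m)
    (hI : main_scalar A F m Is)
    (hphi : anisotropic_conformal c A F eps m Is phi) :
  let Fbar := fun a => change (F a) (phi a) in
  [/\ (forall a p, A a p ->
        (horizontal_C_at (F a) (F a) (phi a) p <->
         riemannian_at (F a) p \/ hder2 (F a) (m a) (phi a) p = 0)),
      (forall a p, A a p ->
        (horizontal_C_at (F a) (Fbar a) (phi a) p <->
         Is a p = eps / 2 *
           (vder2 (F a) (m a) (rho eps (F a) (m a) (Is a) (phi a)) p
              / rho eps (F a) (m a) (Is a) (phi a) p
            - 4 * vder2 (F a) (m a) (phi a) p)
         \/ hder2 (F a) (m a) (phi a) p =
            hder1 (F a) (m a) (phi a) p * vder2 (F a) (m a) (phi a) p)) &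
      (non_riemannian A F -> non_riemannian A Fbar ->
        (horizontal_C A F F phi /\ horizontal_C A F Fbar phi <->
         same_geodesic_spray A F Fbar))].
Proof.
move=> Fbar.
have [_ oA A0 _ _] := hA.
have [[sF _] hF1 gU] := hF; have [[sphi _] hphi0 hW'] := hphi.
have [eps1 hm'] := hm.
have eps2 : eps * eps = 1 by case: eps1 => ->; rewrite ?mulrNN mul1r.
have U0 a p : A a p -> p.2 != 0 by move=> /A0[].
have eF a : euler (A a) 1 (F a).
  apply: (@homogeneous_euler _ _ 1); first by move=> p t; exact: hF1.
  by move=> p; exact: smooth_on_diff.
have ephi a : euler (A a) 0 (phi a).
  apply: (@homogeneous_euler _ _ 0); first by move=> p t; exact: hphi0.
  by move=> p; exact: smooth_on_diff.
have dm a p i : A a p -> differentiable (fun q => m a q 0 i) p.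
  move=> Ap; have dma : differentiable (m a) p by exact: ((hm' a).1 [::]).
  exact: (differentiable_comp dma (differentiable_coord _ 0 i)).
have gE a p (Ap : A a p) i j := (hm' a).2 p Ap i j.
have hW a p : A a p -> sigma eps (F a) (m a) (Is a) (phi a) p + eps -
    vder2 (F a) (m a) (phi a) p ^+ 2 != 0.
  by move=> Ap; rewrite [_ + eps]addrC; exact: hW'.
split=> [a p Ap|a p Ap|nF nFb].
- exact: (horizontal_C_metric (oA a) (U0 a) (sF a) (eF a) (gU a) (gE a) (hI a) (phi a) Ap).
- exact: (horizontal_C_change (oA a) (U0 a) (sF a) (eF a) (gU a) eps2 (dm a) (gE a)
    (hI a) (sphi a) (ephi a) (hW a) Ap).1.
have main a := horizontal_both_iff (oA a) (U0 a) (sF a) (eF a) (gU a) eps2 (dm a)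
  (gE a) (hI a) (sphi a) (ephi a) (hW a) (nF a) (nFb a).
split=> [[hC hCb] a p Ap i|same].
  by apply: ((main a).1 (conj (hC a) (hCb a)) i p Ap).
by split=> a p Ap; have [h1 h2] := (main a).2 (fun i p Ap => same a p Ap i);
  [exact: h1|exact: h2].
Qed.
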